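(* Let $B'\subset\mathbb{P}^5$ be the threefold over $\mathbb{Q}$ defined by $\sigma_1=\sigma_4=0$, where $\sigma_1,\sigma_4$ are the elementary symmetric functions of degrees $1$ and $4$ in the coordinates $x_1,\ldots,x_6$. Then $B'$ is birational over $\mathbb{Q}$ to the elliptic threefold in $\mathbb{P}^2\times\mathbb{A}^2$ (with coordinates $(X:Y:Z)$ on $\mathbb{P}^2$ and $(u,v)$ on $\mathbb{A}^2$) defined by $$\begin{aligned} C_{(u,v)}\colon\;& (u+v-1)XY(X+Y)+(-uv+u+v)(X^2+Y^2)Z\\ &+(-u^2-3uv+3u-v^2+3v-1)XYZ+(u^2v+uv^2-uv)Z^3\\ &+(u^2v-u^2+uv^2-3uv+u-v^2+v)(X+Y)Z^2=0, \end{aligned}$$ where $C_{(u,v)}$ has rational flex points $(1:0:0)$, $(0:1:0)$, $(1:-1:0)$. The map to $B'$ is given by $$(x_1:x_2:x_3:x_4:x_5:x_6)=(X:Y:-uZ:-vZ:Z:-X-Y+(u+v-1)Z).$$ Furthermore, $B'(\mathbb{Q})$ is Zariski-dense in $B'$.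
   Context: The threefold is fibred over $\mathbb{A}^2$ with fibre over $(u,v)$ the plane cubic curve $C_{(u,v)}$; ''elliptic threefold'' means that the general fibre is a genus one curve (with a section, e.g. one of the given flex points). *)

(* Defs.v *)
From HB Require Import structures.
From mathcomp Require Import all_boot all_order all_algebra all_field.
From mathcomp Require Import mpoly.

Set Implicit Arguments.
Unset Strict Implicit.
Unset Printing Implicit Defensive.

Import GRing.Theory Num.Theory.
Local Open Scope ring_scope.

(* Varieties over Q are represented by their points over algC, the algebraic
   closure of Q; "over Q" means that all equations and all polynomials defining
   maps have coefficients in rat.  The ambient spaces are P^n x A^m (P^5 is
   P^5 x A^0); their polynomials have the n.+1 homogeneous coordinates as first
   block of variables and the m affine coordinates as second block. *)

Section AmbientSpace.
Variables n m : nat.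

(* A pair (x, y) stands for a point of P^n x A^m when x != 0; distinct pairs may
   represent the same point, see [same_point]. *)
Definition ppoint : Type := ('rV[algC]_n.+1 * 'rV[algC]_m)%type.

Definition coords (P : ppoint) : 'I_(n.+1 + m) -> algC := row_mx P.1 P.2 ord0.

Definition same_point (P Q : ppoint) : Prop :=
  Q.2 = P.2 /\ exists2 t : algC, t != 0 & Q.1 = t *: P.1.

Definition xhomog (R : comNzRingType) (d : nat) (p : {mpoly R[n.+1 + m]}) : bool :=
  all (fun mon : 'X_{1..n.+1 + m} => \sum_(i < n.+1) mon (lshift m i) == d)%N
      (msupp p).

Definition evalQ (p : {mpoly rat[n.+1 + m]}) (P : ppoint) : algC :=
  (map_mpoly ratr p).@[coords P].

Definition zero_locus (eqs : seq {mpoly rat[n.+1 + m]}) (P : ppoint) : Prop :=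
  P.1 != 0 /\ forall p, p \in eqs -> evalQ p P = 0.

Definition rational_points (X : ppoint -> Prop) (P : ppoint) : Prop :=
  X P /\ exists (x : 'rV[rat]_n.+1) (y : 'rV[rat]_m),
           same_point P (map_mx ratr x, map_mx ratr y).

Definition zariski_dense (S X : ppoint -> Prop) : Prop :=
  (forall P, S P -> X P) /\
  forall (d : nat) (g : {mpoly algC[n.+1 + m]}), xhomog d g ->
    (forall P, S P -> g.@[coords P] = 0) -> forall P, X P -> g.@[coords P] = 0.

End AmbientSpace.

(* P |-> ((proj_0 P : ... : proj_n' P), (num_j P / den P)_j) *)
Record ratmap (n m n' m' : nat) := RatMap {
  rm_proj : 'I_n'.+1 -> {mpoly rat[n.+1 + m]};
  rm_num : 'I_m' -> {mpoly rat[n.+1 + m]};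
  rm_den : {mpoly rat[n.+1 + m]}
}.

Section RationalMaps.
Variables n m n' m' : nat.
Implicit Type f : ratmap n m n' m'.

Definition rm_homog f : Prop :=
  (exists d, forall i, xhomog d (rm_proj f i)) /\
  (exists d, xhomog d (rm_den f) /\ forall j, xhomog d (rm_num f j)).

Definition rm_dom f (P : ppoint n m) : Prop :=
  (exists i, evalQ (rm_proj f i) P != 0) /\ evalQ (rm_den f) P != 0.

Definition rm_app f (P : ppoint n m) : ppoint n' m' :=
  (\row_i evalQ (rm_proj f i) P,
   \row_j (evalQ (rm_num f j) P / evalQ (rm_den f) P)).

Definition rational_map (X : ppoint n m -> Prop) (Y : ppoint n' m' -> Prop) f :
    Prop :=
  [/\ rm_homog f,
      zariski_dense (fun P => X P /\ rm_dom f P) X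
    & forall P, X P -> rm_dom f P -> Y (rm_app f P)].

End RationalMaps.

(* The composite g o f is defined as a rational map X --> X and is the identity. *)
Definition rm_retraction n m n' m' (X : ppoint n m -> Prop)
    (f : ratmap n m n' m') (g : ratmap n' m' n m) : Prop :=
  zariski_dense (fun P => [/\ X P, rm_dom f P & rm_dom g (rm_app f P)]) X /\
  forall P, X P -> rm_dom f P -> rm_dom g (rm_app f P) ->
    same_point P (rm_app g (rm_app f P)).

Definition birational_map n m n' m' (X : ppoint n m -> Prop)
    (Y : ppoint n' m' -> Prop) (f : ratmap n m n' m') : Prop :=
  rational_map X Y f /\
  exists g : ratmap n' m' n m,
    [/\ rational_map Y X g, rm_retraction X f g & rm_retraction Y g f].

Definition vec3 (a b c : algC) : 'rV[algC]_3 := \row_(i < 3) [:: a; b; c]`_i.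

(* Projective plane curves F = 0. *)
Section PlaneCurves.
Variable F : {mpoly algC[3]}.

Definition on_curve (P : 'rV[algC]_3) : Prop := P != 0 /\ F.@[P 0] = 0.

Definition nonsingular_at (P : 'rV[algC]_3) : Prop :=
  exists i : 'I_3, (F^`M(i)).@[P 0] != 0.

Definition nonsingular_curve : Prop :=
  forall P, on_curve P -> nonsingular_at P.

Definition irreducible_curve : Prop :=
  (1 < msize F)%N /\
  forall G H : {mpoly algC[3]}, F = G * H -> (msize G <= 1)%N \/ (msize H <= 1)%N.

(* h is the dimension of the degree d part of the homogeneous coordinate ring
   algC[X, Y, Z] / (F): the classes of the b i form a basis of it. *)
Definition hilbert_value (d h : nat) : Prop :=
  exists b : 'I_h -> {mpoly algC[3]},
    (forall i, b i \is d.-homog) /\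
    forall p : {mpoly algC[3]}, p \is d.-homog ->
      exists! c : 'rV[algC]_h,
        exists q : {mpoly algC[3]}, p = \sum_i c 0 i *: b i + q * F.

(* The Hilbert polynomial is e * d + 1 - g; for a nonsingular irreducible curve
   the arithmetic genus g is the genus. *)
Definition has_genus (g : nat) : Prop :=
  exists e N : nat, forall d : nat, (N <= d)%N ->
    exists2 h : nat, hilbert_value d h & (h + g = e * d + 1)%N.

Definition genus_one_curve : Prop :=
  [/\ exists k : nat, F \is k.-homog,
      irreducible_curve, nonsingular_curve & has_genus 1].

(* F restricted to the line through P and Q, parametrised by t |-> P + t Q *)
Definition restrict_line (P Q : 'rV[algC]_3) : {poly algC} :=
  mmap (@polyC algC) (fun i => (P 0 i)%:P + Q 0 i *: 'X) F.

(* P is a nonsingular point at which the tangent line meets the curve with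
   multiplicity at least 3 (infinite if the tangent is a component). *)
Definition flex_point (P : 'rV[algC]_3) : Prop :=
  [/\ on_curve P, nonsingular_at P
    & forall Q : 'rV[algC]_3,
        \sum_(i < 3) (F^`M(i)).@[P 0] * Q 0 i = 0 ->
        'X^3 %| restrict_line P Q].

End PlaneCurves.

Definition cubic_form (R : comNzRingType) (u v X Y Z : R) : R :=
  (u + v - 1) * (X * Y * (X + Y))
  + (- (u * v) + u + v) * ((X ^+ 2 + Y ^+ 2) * Z)
  + (- u ^+ 2 - 3%:R * u * v + 3%:R * u - v ^+ 2 + 3%:R * v - 1) * (X * Y * Z)
  + (u ^+ 2 * v + u * v ^+ 2 - u * v) * Z ^+ 3
  + (u ^+ 2 * v - u ^+ 2 + u * v ^+ 2 - 3%:R * u * v + u - v ^+ 2 + v)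
    * ((X + Y) * Z ^+ 2).

Definition curveC (u v : algC) : {mpoly algC[3]} :=
  cubic_form u%:MP v%:MP 'X_(inord 0) 'X_(inord 1) 'X_(inord 2).

Definition PX : {mpoly rat[3 + 2]} := 'X_(lshift 2 (inord 0 : 'I_3)).
Definition PY : {mpoly rat[3 + 2]} := 'X_(lshift 2 (inord 1 : 'I_3)).
Definition PZ : {mpoly rat[3 + 2]} := 'X_(lshift 2 (inord 2 : 'I_3)).
Definition Pu : {mpoly rat[3 + 2]} := 'X_(rshift 3 (inord 0 : 'I_2)).
Definition Pv : {mpoly rat[3 + 2]} := 'X_(rshift 3 (inord 1 : 'I_2)).

Definition elliptic_threefold : ppoint 2 2 -> Prop :=
  zero_locus [:: cubic_form Pu Pv PX PY PZ].

Definition Bprime : ppoint 5 0 -> Prop :=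
  zero_locus [:: mesym (6 + 0) rat 1; mesym (6 + 0) rat 4].

(* The target P^5 x A^0 has no affine coordinates: [rm_num] is empty. *)
Definition phi : ratmap 2 2 5 0 := {|
  rm_proj := fun i : 'I_6 =>
    [:: PX; PY; - (Pu * PZ); - (Pv * PZ); PZ; - PX - PY + (Pu + Pv - 1) * PZ]`_i;
  rm_num := fun=> 0;
  rm_den := 1
|}.

(* Main.v *)
(** Write e1, ..., e4 for the elementary symmetric functions of x3, ..., x6.  On B'
    the coordinates x1, x2 are the roots of T^2 + e1 T + (e1 e3 - e4) / e2, so B' is
    birational to the double cover w^2 = e2 (e1^2 e2 - 4 e1 e3 + 4 e4) of P^3.  For
    fixed x3, x4, x5 the cover is a curve of genus one in x6, with a duplication
    formula.  When x3, ..., x6 are 2-adic units and e2 has 2-adic valuation at least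
    3, duplication keeps x6 a unit and raises the valuation of e2 by 2, so it never
    stops producing new values of x6; the same holds for x5 and x4 by symmetry.
    Starting from (9, 3, -5, -25) this gives a Zariski-dense set of rational
    (x3, ..., x6) that lift to rational points of B'.  A form vanishing at both lifts
    of a point reduces to A + w B with A = B = 0, hence vanishes wherever e2 is
    nonzero; and no point of B' has e2 = 0 for all choices of the pair {x1, x2}.

    The inverse of phi is (x1 : x2 : x5; - x3 / x5, - x4 / x5), and the points of the
    elliptic threefold with Z = 0 are limits of points with Z != 0.  A cubic with no
    singular point is irreducible, since two components would meet in a singular
    point, and the Hilbert function of any plane cubic is
    C(d + 2, 2) - C(d - 1, 2) = 3 d. *)

From HB Require Import structures.
Require Import Defs.
From mathcomp Require Import all_boot all_order all_algebra all_field.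
From mathcomp Require Import perm mpoly ring zify.
Set Implicit Arguments.
Unset Strict Implicit.
Unset Printing Implicit Defensive.
Import Order.TTheory GRing.Theory Num.Theory.
Local Open Scope ring_scope.

(** * Elementary symmetric functions and 2-adic units *)

Section ElementarySymmetric.
Variable R : comNzRingType.
Implicit Types a b c d : R.

Definition esym1 a b c d := a + b + c + d.
Definition esym2 a b c d := a * b + a * c + a * d + b * c + b * d + c * d.
Definition esym3 a b c d := a * b * c + a * b * d + a * c * d + b * c * d.
Definition esym4 a b c d := a * b * c * d.

(* On B', (e2 (x1 - x2))^2 is this polynomial in x3, ..., x6. *)
Definition branch a b c d :=
  esym2 a b c d * (esym1 a b c d ^+ 2 * esym2 a b c d
    - 4%:R * esym1 a b c d * esym3 a b c d + 4%:R * esym4 a b c d).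

End ElementarySymmetric.

Section Morphism.
Variables (R S : comNzRingType) (f : {rmorphism R -> S}).

Lemma rmorph_esym1 a b c d : f (esym1 a b c d) = esym1 (f a) (f b) (f c) (f d).
Proof. by rewrite /esym1 !rmorphD. Qed.

Lemma rmorph_esym2 a b c d : f (esym2 a b c d) = esym2 (f a) (f b) (f c) (f d).
Proof. by rewrite /esym2 !rmorphD !rmorphM. Qed.

Lemma rmorph_esym3 a b c d : f (esym3 a b c d) = esym3 (f a) (f b) (f c) (f d).
Proof. by rewrite /esym3 !rmorphD !rmorphM. Qed.

Lemma rmorph_esym4 a b c d : f (esym4 a b c d) = esym4 (f a) (f b) (f c) (f d).
Proof. by rewrite /esym4 !rmorphM. Qed.

Lemma rmorph_branch a b c d : f (branch a b c d) = branch (f a) (f b) (f c) (f d).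
Proof.
rewrite /branch -!rmorph_esym1 -!rmorph_esym2 -rmorph_esym3 -rmorph_esym4.
move: (esym1 _ _ _ _) (esym2 _ _ _ _) (esym3 _ _ _ _) (esym4 _ _ _ _) => p q r s.
by rewrite rmorphM rmorphD rmorphB !rmorphM !rmorph_nat.
Qed.

End Morphism.

(** * The localisation of the integers at 2 *)

Definition integral2 (x : rat) : Prop :=
  exists n k : int, x = n%:~R / (2 * k + 1)%:~R.

Lemma odd_neq0 (k : int) : (2 * k + 1)%:~R != 0 :> rat.
Proof. by rewrite intr_eq0; lia. Qed.

Lemma integral2_int (n : int) : integral2 n%:~R.
Proof. by exists n, 0; rewrite mulr0 add0r divr1. Qed.

Lemma integral2D x y : integral2 x -> integral2 y -> integral2 (x + y).
Proof.
move=> [n [k ->]] [m [l ->]]; exists (n * (2 * l + 1) + m * (2 * k + 1)).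
exists (2 * k * l + k + l).
rewrite addf_div ?odd_neq0 // -!intrM -intrD; congr (_ / _%:~R); ring.
Qed.

Lemma integral2M x y : integral2 x -> integral2 y -> integral2 (x * y).
Proof.
move=> [n [k ->]] [m [l ->]]; exists (n * m), (2 * k * l + k + l).
rewrite mulf_div -!intrM; congr (_ / _%:~R); ring.
Qed.

Lemma integral2N x : integral2 x -> integral2 (- x).
Proof. by rewrite -mulN1r; apply: integral2M; apply: (integral2_int (-1)). Qed.

Lemma integral2_nat n : integral2 n%:R.
Proof. exact: (integral2_int n). Qed.

Lemma integral2X x n : integral2 x -> integral2 (x ^+ n).
Proof.
move=> hx; elim: n => [|n IH]; first exact: (integral2_nat 1).
by rewrite exprS; apply: integral2M.
Qed.

(** The residue field at 2 has two elements, so the units are exactly the elements congruent to 1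
    modulo 2. *)
Definition unit2 (x : rat) : Prop := exists2 r, integral2 r & x = 1 + 2 * r.

Lemma unit2_integral x : unit2 x -> integral2 x.
Proof.
move=> [r hr ->]; apply: integral2D; first exact: (integral2_nat 1).
by apply: integral2M => //; apply: (integral2_nat 2).
Qed.

Lemma unit2D2 x y : unit2 x -> integral2 y -> unit2 (x + 2 * y).
Proof.
by move=> [r hr ->] hy; exists (r + y); [apply: integral2D | ring].
Qed.

(** The residues add up to 1 + 1 + 1 = 1 modulo 2. This is applied to the elementary symmetric
    functions of three units. *)
Lemma unit2D3 x y z : unit2 x -> unit2 y -> unit2 z -> unit2 (x + y + z).
Proof.
move=> ux [r hr ->] [s hs ->].
have -> : x + (1 + 2 * r) + (1 + 2 * s) = x + 2 * (1 + r + s) by ring.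
apply: unit2D2 => //; apply: integral2D => //; apply: integral2D => //.
exact: (integral2_nat 1).
Qed.

Lemma unit2M x y : unit2 x -> unit2 y -> unit2 (x * y).
Proof.
move=> ux [r hr ->]; have -> : x * (1 + 2 * r) = x + 2 * (x * r) by ring.
by apply: unit2D2 => //; apply: integral2M => //; apply: unit2_integral.
Qed.

Lemma unit2N x : unit2 x -> unit2 (- x).
Proof.
move=> ux; have -> : - x = x + 2 * (- x) by ring.
by apply: unit2D2 => //; apply/integral2N/unit2_integral.
Qed.

Lemma unit2X x n : unit2 x -> unit2 (x ^+ n).
Proof.
move=> ux; elim: n => [|n IH]; last by rewrite exprS; apply: unit2M.
by exists 0; [apply: (integral2_int 0) | ring].
Qed.

Lemma unit2_neq0 x : unit2 x -> x != 0.
Proof.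
move=> [_ [n [k ->]] ->]; apply: contraTneq isT => /eqP.
have h0 := odd_neq0 k.
rewrite -(mulIr_eq0 _ (mulIf h0)) mulrDl mul1r -mulrA divfK //.
by rewrite -(intrM _ 2) -intrD intr_eq0; lia.
Qed.

Lemma unit2_not_even x y : unit2 x -> integral2 y -> x != 2 * y.
Proof.
move=> ux hy; rewrite -subr_eq0.
have -> : x - 2 * y = x + 2 * (- y) by ring.
by apply/unit2_neq0/unit2D2 => //; apply: integral2N.
Qed.

Lemma unit2V x : unit2 x -> unit2 x^-1.
Proof.
move=> ux; have x0 := unit2_neq0 ux; case: ux x0 => _ [n [k ->]] -> x0.
have h0 := odd_neq0 k.
(* The numerator over the common denominator is odd again, so it can serve as the denominator of the
   inverse. *)
have e : 1 + 2 * (n%:~R / (2 * k + 1)%:~R) =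
         (2 * (k + n) + 1)%:~R / (2 * k + 1)%:~R :> rat.
  apply: (mulIf h0); rewrite divfK // mulrDl mul1r -mulrA divfK //.
  by rewrite -(intrM _ 2) -intrD; congr _%:~R; ring.
exists ((- n)%:~R / (2 * (k + n) + 1)%:~R); first by exists (- n), (k + n).
have h1 := odd_neq0 (k + n).
rewrite e invf_div; apply: (mulIf h1).
rewrite divfK // [RHS]mulrDl mul1r -mulrA divfK //.
by rewrite -(intrM _ 2) -intrD; congr _%:~R; ring.
Qed.

Definition val2 (k : nat) (x : rat) : Prop := exists2 u, unit2 u & x = 2 ^+ k * u.

Lemma val2_neq0 k x : val2 k x -> x != 0.
Proof. by move=> [u uu ->]; rewrite mulf_neq0 ?expf_neq0 // unit2_neq0. Qed.

(** If k < l, cancelling 2^k would equate a unit with twice an integral element. *)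
Lemma val2_inj k l x : val2 k x -> val2 l x -> k = l.
Proof.
wlog lt : k l / (k < l)%N => [wl|] vk vl.
  case: (ltngtP k l) => // h; [exact: wl h vk vl | exact/esym/(wl _ _ h)].
case: vk vl => u uu -> [v uv] /eqP; rewrite -(subnKC lt) exprD exprSr -!mulrA.
have p0 : (2 ^+ k : rat) != 0 by rewrite expf_neq0.
rewrite (inj_eq (mulfI p0)) => /eqP e.
have /eqP[] := unit2_not_even uu (integral2M (integral2X (l - k.+1)
  (integral2_nat 2)) (unit2_integral uv)).
exact: e.
Qed.

(** * Duplication *)

Section Duplication.
Variables (F : fieldType) (A K : F).
Implicit Type e : F.

(* With x = - K / e the curve W^2 = quartic_model e becomes
   y^2 + A x y - K y = x^3, and duplication there sends e to dup e. *)
Definition quartic_model e := e * (e * (e + A) ^+ 2 - 4%:R * K).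
Definition dup_den e := K + A * e ^+ 2 + 2%:R * e ^+ 3.
Definition dup e := - quartic_model e / dup_den e.
(** Up to sign, [dup_root e / dup_den e ^+ 2] is the factor by which doubling multiplies the
    ordinate W. *)
Definition dup_root e :=
  2%:R * K ^+ 2 - A ^+ 2 * K * e - 5%:R * A * K * e ^+ 2 - 10%:R * K * e ^+ 3
  - A * e ^+ 5 - e ^+ 6.

Lemma quartic_model_dup e : dup_den e != 0 ->
  quartic_model (dup e) = quartic_model e * (dup_root e / dup_den e ^+ 2) ^+ 2.
Proof.
move=> N0; rewrite /dup; set N := dup_den e in N0 *.
(* Write q for [quartic_model e]. The model at - q / N equals q / N^4 times the left-hand side,
   which this identity shows to be a square. *)
have h : quartic_model e * (A * N - quartic_model e) ^+ 2 + 4%:R * K * N ^+ 3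
         = dup_root e ^+ 2.
  by rewrite /N /quartic_model /dup_den /dup_root; ring.
rewrite expr_div_n -h {1}/quartic_model; move: (quartic_model e) => q.
by field.
Qed.

End Duplication.

(** [cubic_a] and [cubic_k] are the parameters A and K of the model for [branch a b c d] seen as a
    quartic in [d]. The coordinate e is [esym2 a b c d], which is affine in [d] with slope
    [a + b + c]. *)
Definition cubic_a (a b c : rat) :=
  (a + b + c) ^+ 2 - 3%:R * (a * b + a * c + b * c).
Definition cubic_k (a b c : rat) :=
  (a + b + c) ^+ 3 * (a * b * c)
  - (a + b + c) ^+ 2 * (a * b + a * c + b * c) ^+ 2
  + (a * b + a * c + b * c) ^+ 3.

Lemma quartic_modelE a b c d :
  quartic_model (cubic_a a b c) (cubic_k a b c) (esym2 a b c d) =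
  (a + b + c) ^+ 2 * branch a b c d.
Proof.
rewrite /quartic_model /branch /cubic_a /cubic_k /esym1 /esym2 /esym3 /esym4.
by ring.
Qed.

(** The index [k] is the exact valuation of [esym2]; its growth tells successive points apart. The
    square root of [branch] provides the rational lifts to B'. *)
Definition good (k : nat) (a b c d : rat) : Prop :=
  [/\ unit2 a /\ unit2 b, unit2 c /\ unit2 d, (2 < k)%N /\ val2 k (esym2 a b c d)
    & exists w, branch a b c d = w ^+ 2].

(** Solves e = (a b + a c + b c) + (a + b + c) x for x, where e is the doubled coordinate. *)
Definition next (a b c d : rat) :=
  (dup (cubic_a a b c) (cubic_k a b c) (esym2 a b c d)
   - (a * b + a * c + b * c)) / (a + b + c).

Lemma unit2_cubic_k a b c : unit2 a -> unit2 b -> unit2 c -> unit2 (cubic_k a b c).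
Proof.
move=> ua ub uc.
have u1 := unit2D3 ua ub uc.
have u2 := unit2D3 (unit2M ua ub) (unit2M ua uc) (unit2M ub uc).
have u3 := unit2M (unit2M ua ub) uc.
apply: unit2D3; last exact: unit2X.
  by apply: unit2M => //; apply: unit2X.
by apply/unit2N/unit2M; apply: unit2X.
Qed.

Lemma integral2_cubic_a a b c :
  unit2 a -> unit2 b -> unit2 c -> integral2 (cubic_a a b c).
Proof.
move=> ua ub uc.
have u1 := unit2D3 ua ub uc.
have u2 := unit2D3 (unit2M ua ub) (unit2M ua uc) (unit2M ub uc).
apply/integral2D; first exact/integral2X/unit2_integral.
apply/integral2N/integral2M; first exact: (integral2_nat 3).
exact: unit2_integral.
Qed.

(** Since 8 divides [e], the term e (e + A)^2 is divisible by 8 while 4 K has valuation exactly 2.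
    Hence [quartic_model] has valuation k + 2, and the denominator is congruent to the unit K modulo
    2. *)
Lemma val2_dup (A K : rat) k e : integral2 A -> unit2 K -> (2 < k)%N -> val2 k e ->
  unit2 (dup_den A K e) /\ val2 k.+2 (dup A K e).
Proof.
move=> iA uK k3 [u uu ->].
have iu := unit2_integral uu; have iK := unit2_integral uK.
have [j ->] : exists j, k = j.+3 by exists (k - 3)%N; lia.
have i2 n : integral2 (2 ^+ n) by exact/integral2X/(integral2_nat 2).
set v := 2 ^+ j * u; have iv : integral2 v by apply: integral2M.
have -> : 2 ^+ j.+3 * u = 8 * v by rewrite /v !exprS; ring.
have uN : unit2 (dup_den A K (8 * v)).
  have -> : dup_den A K (8 * v)
      = K + 2 * (32%:R * A * v ^+ 2 + 512%:R * v ^+ 3) by rewrite /dup_den; ring.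
  apply: (unit2D2 uK); apply: integral2D.
    exact: (integral2M (integral2M (integral2_nat 32) iA) (integral2X 2 iv)).
  exact: (integral2M (integral2_nat 512) (integral2X 3 iv)).
(* Here [v] is e / 8. Taking 4 out of the second factor of [quartic_model] leaves the unit - K + 2 v
   (8 v + A)^2. *)
split=> //; exists (- u * (- K + 2 * (v * (8 * v + A) ^+ 2)) / dup_den A K (8 * v)).
  apply: unit2M; last exact: unit2V.
  apply: unit2M; first exact: unit2N.
  apply: unit2D2; first exact: unit2N.
  apply: (integral2M iv); apply: integral2X.
  exact: (integral2D (integral2M (integral2_nat 8) iv) iA).
rewrite /dup; move: (dup_den _ _ _)^-1 => n.
by rewrite /quartic_model /v !exprS; ring.
Qed.

(** The new coordinate is an even number minus an odd one, divided by an odd one, hence a unit.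
    Doubling multiplies [branch] by a square, so it stays a square. *)
Lemma good_next k a b c d : good k a b c d -> good k.+2 a b c (next a b c d).
Proof.
move=> [[ua ub] [uc ud] [k3 ve] [w Dw]].
have uK := unit2_cubic_k ua ub uc; have iA := integral2_cubic_a ua ub uc.
have u1 := unit2D3 ua ub uc; have f0 := unit2_neq0 u1.
have u2 := unit2D3 (unit2M ua ub) (unit2M ua uc) (unit2M ub uc).
have [uN ve'] := val2_dup iA uK k3 ve; have N0 := unit2_neq0 uN.
have eE : esym2 a b c (next a b c d)
          = dup (cubic_a a b c) (cubic_k a b c) (esym2 a b c d).
  by rewrite /next /esym2; field.
split=> //.
- split=> //; apply: unit2M; last exact: unit2V.
  rewrite addrC; case: ve' => u uu ->; rewrite exprS -mulrA.
  apply: unit2D2; first exact: unit2N.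
  by apply/integral2M; [exact/integral2X/(integral2_nat 2) | apply: unit2_integral].
- by rewrite eE; split=> //; lia.
- have := quartic_modelE a b c (next a b c d).
  rewrite eE quartic_model_dup // quartic_modelE Dw -mulrA => /(mulfI _) <- //.
    by eexists; rewrite -exprMn.
  by rewrite expf_neq0.
Qed.

(** The n-th iterate has an [esym2] of valuation k + 2 n, so the iterates are distinct. *)
Lemma good_infinite k a b c d : good k a b c d ->
  exists s : nat -> rat, injective s /\ forall n, exists l, good l a b c (s n).
Proof.
move=> g; have gs n : good (k + n.*2) a b c (iter n (next a b c) d).
  by elim: n => [|n IH]; rewrite ?addn0 // iterS doubleS !addnS; apply: good_next.
exists (fun n => iter n (next a b c) d); split=> [n m e|n]; last by eexists.
have [_ _ [_ vn] _] := gs n; have [_ _ [_ vm] _] := gs m.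
move: vn; rewrite e => /val2_inj/(_ vm)/eqP; rewrite eqn_add2l => /eqP.
exact: double_inj.
Qed.

Lemma good_swap34 k a b c d : good k a b c d -> good k a b d c.
Proof.
move=> [[ua ub] [uc ud] vk sq]; split=> //.
  by have -> : esym2 a b d c = esym2 a b c d by rewrite /esym2; ring.
have -> : branch a b d c = branch a b c d => //.
by rewrite /branch /esym1 /esym2 /esym3 /esym4; ring.
Qed.

Lemma good_swap24 k a b c d : good k a b c d -> good k a d c b.
Proof.
move=> [[ua ub] [uc ud] vk sq]; split=> //.
  by have -> : esym2 a d c b = esym2 a b c d by rewrite /esym2; ring.
have -> : branch a d c b = branch a b c d => //.
by rewrite /branch /esym1 /esym2 /esym3 /esym4; ring.
Qed.

Lemma good_start : good 4 9 3 (- 5) (- 25).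
Proof.
split; [split|split|split=> //|].
- by exists 4; [apply: (integral2_nat 4) | ring].
- by exists 1; [apply: (integral2_nat 1) | ring].
- by exists (- 3); [apply: (integral2_int (- 3)) | ring].
- by exists (- 13); [apply: (integral2_int (- 13)) | ring].
(* Here [esym2] is - 208 = 2^4 (- 13), and [branch] is 876096 = 936^2. *)
- exists (- 13); last by rewrite /esym2; ring.
  by exists (- 7); [apply: (integral2_int (- 7)) | ring].
- by exists 936; rewrite /branch /esym1 /esym2 /esym3 /esym4; ring.
Qed.

(** If [branch] vanished, the doubled coordinate would be 0, although [val2_dup] gives it a finite
    valuation. *)
Lemma branch_neq0 k a b c d : good k a b c d ->
  branch a b c d != 0 /\ esym2 a b c d != 0.
Proof.
move=> [[ua ub] [uc ud] [k3 ve] _]; split; last exact: val2_neq0 ve.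
have uK := unit2_cubic_k ua ub uc; have iA := integral2_cubic_a ua ub uc.
have [_ /val2_neq0] := val2_dup iA uK k3 ve.
by apply: contraNneq => D0; rewrite /dup quartic_modelE D0 mulr0 oppr0 mul0r.
Qed.

(** * Polynomials vanishing on infinite sets *)

Section PolynomialTools.
Variable R : idomainType.

Lemma poly_eq0_infinite (p : {poly R}) (s : nat -> R) :
  injective s -> (forall n, p.[s n] = 0) -> p = 0.
Proof.
move=> inj_s ps; apply/eqP/negPn/negP => p0.
have /(_ (mkseq s (size p))) := max_poly_roots p0.
rewrite mkseq_uniq // size_mkseq ltnn => /(_ _ isT) h.
by have // : false by apply: h; apply/allP => _ /mapP[n _ ->]; apply/rootP.
Qed.

End PolynomialTools.

Lemma rmorph_mmap_eval (R S : comNzRingType) (h : R -> S)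
    (f : {rmorphism S -> R}) n (p : {mpoly R[n]}) (c : 'I_n -> S) :
  cancel h f -> f (mmap h c p) = p.@[fun i => f (c i)].
Proof.
move=> hK; rewrite mevalE /mmap rmorph_sum; apply: eq_bigr => m _.
rewrite rmorphM hK /mmap1 rmorph_prod; congr (_ * _).
by apply: eq_bigr => i _; rewrite rmorphXn.
Qed.

Lemma meval_horner (R : comNzRingType) n (p : {mpoly R[n]}) (c : 'I_n -> {poly R}) t :
  p.@[fun i => (c i).[t]] = (mmap (@polyC R) c p).[t].
Proof.
rewrite -[RHS]/(horner_eval t _); apply/esym/rmorph_mmap_eval => x.
exact: hornerC.
Qed.

Lemma meval_mmapC (R : comNzRingType) n k (p : {mpoly R[n]})
    (c : 'I_n -> {mpoly R[k]}) v :
  (mmap (@mpolyC k R) c p).@[v] = p.@[fun i => (c i).@[v]].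
Proof. by rewrite rmorph_mmap_eval //; apply: mevalC. Qed.



(* Restrict both factors to the line joining v to a point where q is nonzero. *)
Lemma meval_cancel (R : numDomainType) n (p q : {mpoly R[n]}) v1 :
  (forall v, p.@[v] * q.@[v] = 0) -> q.@[v1] != 0 -> forall v, p.@[v] = 0.
Proof.
move=> pq0 q1 v; pose c i := (v i)%:P + (v1 i - v i) *: 'X.
have ce t : (fun i => (c i).[t]) =1 (fun i => v i + (v1 i - v i) * t).
  by move=> i; rewrite /c !hornerE.
have : mmap (@polyC R) c p * mmap (@polyC R) c q = 0.
  apply: (@poly_eq0_infinite _ _ (fun n => n%:R)) => [i j /eqP|i].
    by rewrite eqr_nat => /eqP.
  by rewrite hornerM -!meval_horner pq0.
move=> /eqP; rewrite mulf_eq0 => /orP[] /eqP z.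
  have := congr1 (fun r => r.[0]) z; rewrite -meval_horner horner0 => <-.
  by apply: meval_eq => i; rewrite ce mulr0 addr0.
have := congr1 (fun r => r.[1]) z; rewrite -meval_horner horner0 => /eqP.
rewrite (_ : meval _ q = q.@[v1]) ?(negPf q1) //.
by apply: meval_eq => i; rewrite ce mulr1 addrC subrK.
Qed.

Lemma poly_even_odd_sq (R : comNzRingType) (q : {poly R}) (w : R) :
  q.[w] = (even_poly q).[w ^+ 2] + w * (odd_poly q).[w ^+ 2].
Proof.
by rewrite -{1}[q]poly_even_odd !hornerE !horner_comp !hornerE mulrC.
Qed.

(* Reduction modulo W^2 = D. *)
Lemma mpoly_quadratic_split (R : comNzRingType) n k (g : {mpoly R[n]})
    (c : 'I_n -> {poly {mpoly R[k]}}) (D : {mpoly R[k]}) :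
  exists A B : {mpoly R[k]}, forall v w, w ^+ 2 = D.@[v] ->
    g.@[fun i => (map_poly (meval v) (c i)).[w]] = A.@[v] + w * B.@[v].
Proof.
pose q := mmap (@polyC {mpoly R[k]} \o @mpolyC k R) c g.
exists (even_poly q).[D], (odd_poly q).[D] => v w hw.
have hp (p : {poly {mpoly R[k]}}) : p.[D].@[v] = (map_poly (meval v) p).[w ^+ 2].
  by rewrite hw horner_map.
pose f := horner_eval w \o map_poly (meval v) : {rmorphism {poly {mpoly R[k]}} -> R}.
rewrite -[LHS](@rmorph_mmap_eval _ _ (@polyC _ \o @mpolyC k R) f) => [|x]; last first.
  by rewrite /f /= /horner_eval map_polyC hornerC /= mevalC.
rewrite -[LHS]/((map_poly (meval v) q).[w]).
rewrite poly_even_odd_sq !hp; congr (_.[_] + w * _.[_]).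
  by apply/polyP => i; rewrite coef_even_poly !coef_map coef_even_poly.
by apply/polyP => i; rewrite coef_odd_poly !coef_map coef_odd_poly.
Qed.

(** * Rational points of B' *)

(** A form of [mesym] by recursion on the last variable, which simplifies to an explicit polynomial
    for concrete [n] and [k]. *)
Fixpoint elem_sym (R : pzRingType) (n k : nat) (x : nat -> R) : R :=
  match k, n with
  | 0, _ => 1
  | _, 0 => 0
  | k'.+1, n'.+1 => elem_sym n' k x + elem_sym n' k' x * x n'
  end.

Lemma meval_mwiden (R : comNzRingType) n (p : {mpoly R[n]}) v :
  (mwiden p).@[v] = p.@[fun i => v (widen_ord (leqnSn n) i)].
Proof. by rewrite meval_mmapC; apply: meval_eq => i; rewrite mevalXU. Qed.

Lemma meval_mesym (R : comNzRingType) n k (x : nat -> R) :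
  (mesym n R k).@[fun i => x i] = elem_sym n k x.
Proof.
elim: n k => [|n IH] [|k] /=; try by rewrite mesym0E meval1.
  by rewrite mesym_geqnE // meval0.
by rewrite mesymSS mevalD mevalM mevalXU !meval_mwiden /= !IH.
Qed.

Lemma map_mesym n k :
  map_mpoly ratr (mesym n rat k) = mesym n algC k.
Proof.
rewrite /mesym rmorph_sum; apply: eq_bigr => h _.
by rewrite rmorph_prod; apply: eq_bigr => i _ /=; rewrite map_mpolyX.
Qed.

Lemma evalQ_mesym n m k (P : ppoint n m) (x : nat -> algC) :
  (forall i, coords P i = x i) -> evalQ (mesym _ rat k) P = elem_sym (n.+1 + m) k x.
Proof. by move=> hx; rewrite -meval_mesym -(meval_eq _ hx) -map_mesym. Qed.

Definition xc (P : ppoint 5 0) (k : nat) : algC := P.1 0 (inord k).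

Lemma coords_xc (P : ppoint 5 0) i : coords P i = xc P i.
Proof.
have -> : i = lshift 0 (inord i : 'I_6) by apply/val_inj; rewrite /= inordK.
by rewrite /coords row_mxEl /xc /= inordK.
Qed.

(** Separating the first two coordinates shows that they enter only through their sum and product,
    as the roots of a quadratic over the other four. *)
Lemma BprimeE (P : ppoint 5 0) : Bprime P <->
  [/\ P.1 != 0, xc P 0 + xc P 1 + esym1 (xc P 2) (xc P 3) (xc P 4) (xc P 5) = 0
    & let: (a, b, c, d) := (xc P 2, xc P 3, xc P 4, xc P 5) in
      xc P 0 * xc P 1 * esym2 a b c d + (xc P 0 + xc P 1) * esym3 a b c d
      + esym4 a b c d = 0].
Proof.
have e1 : evalQ (mesym (6 + 0) rat 1) P =
    xc P 0 + xc P 1 + esym1 (xc P 2) (xc P 3) (xc P 4) (xc P 5).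
  by rewrite (evalQ_mesym _ (coords_xc P)) /= /esym1; ring.
have e4 : evalQ (mesym (6 + 0) rat 4) P =
    xc P 0 * xc P 1 * esym2 (xc P 2) (xc P 3) (xc P 4) (xc P 5)
    + (xc P 0 + xc P 1) * esym3 (xc P 2) (xc P 3) (xc P 4) (xc P 5)
    + esym4 (xc P 2) (xc P 3) (xc P 4) (xc P 5).
  by rewrite (evalQ_mesym _ (coords_xc P)) /= /esym2 /esym3 /esym4; ring.
split=> [[P0 h]|[P0 h1 h4]].
  split=> //=; rewrite -?e1 -?e4; apply: h; rewrite !inE eqxx ?orbT //.
by split=> // p; rewrite !inE => /orP[/eqP->|/eqP->]; rewrite ?e1 ?e4.
Qed.

Definition pt4 (R : nmodType) (a b c d : R) (i : 'I_4) : R := [:: a; b; c; d]`_i.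

Lemma forall_ord4 (Q : 'I_4 -> Prop) :
  Q (inord 0) -> Q (inord 1) -> Q (inord 2) -> Q (inord 3) -> forall i, Q i.
Proof.
move=> q0 q1 q2 q3 i; rewrite -(inord_val i).
by case: i => [[|[|[|[|]]]]].
Qed.

Lemma pt4E (R : nmodType) (v : 'I_4 -> R) :
  v =1 pt4 (v (inord 0)) (v (inord 1)) (v (inord 2)) (v (inord 3)).
Proof. by apply: forall_ord4; rewrite /pt4 !inordK. Qed.

Lemma horner_pt4 (R : comNzRingType) (a b c d : {poly R}) t :
  (fun i => (pt4 a b c d i).[t]) =1 pt4 a.[t] b.[t] c.[t] d.[t].
Proof. by apply: forall_ord4; rewrite /pt4 !inordK. Qed.

Lemma meval_line_eq0 n (h : {mpoly algC[n]}) (c : 'I_n -> {poly algC})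
    (s : nat -> rat) (t : rat) : t != 0 -> injective s ->
  (forall m, h.@[fun i => (c i).[ratr (t * s m)]] = 0) ->
  forall x, h.@[fun i => (c i).[x]] = 0.
Proof.
move=> t0 inj_s h0 x; rewrite meval_horner.
rewrite (_ : mmap _ c h = 0) ?horner0 //.
apply: (@poly_eq0_infinite _ _ (fun m => ratr (t * s m))) => [i j /fmorph_inj|m].
  by move/(mulfI t0)/inj_s.
by rewrite -meval_horner h0.
Qed.

(** The second, third and fourth coordinates are freed in turn, each by running through an infinite
    sequence of good values while the others stay fixed. The scaling factor [t] then frees the
    first. *)
Lemma good_dense (h : {mpoly algC[4]}) :
  (forall (t : rat) k a b c d, t != 0 -> good k a b c d ->
     h.@[pt4 (ratr (t * a)) (ratr (t * b)) (ratr (t * c)) (ratr (t * d))] = 0) ->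
  forall v, h.@[v] = 0.
Proof.
move=> h0.
have h1 (t : rat) k a b c d : t != 0 -> good k a b c d -> forall y : algC,
    h.@[pt4 (ratr (t * a)) y (ratr (t * c)) (ratr (t * d))] = 0.
  move=> t0 /good_swap24/good_infinite[s [inj_s gs]] y.
  have := @meval_line_eq0 _ h (pt4 (ratr (t * a))%:P 'X (ratr (t * c))%:P
    (ratr (t * d))%:P) s t t0 inj_s _ y.
  rewrite (meval_eq _ (horner_pt4 _ _ _ _ _)) !hornerE; apply=> m.
  rewrite (meval_eq _ (horner_pt4 _ _ _ _ _)) !hornerE.
  by have [l /good_swap24/h0->] := gs m.
have h2 (t : rat) k a b c d : t != 0 -> good k a b c d -> forall y z : algC,
    h.@[pt4 (ratr (t * a)) y z (ratr (t * d))] = 0.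
  move=> t0 /good_swap34/good_infinite[s [inj_s gs]] y z.
  have := @meval_line_eq0 _ h (pt4 (ratr (t * a))%:P y%:P 'X
    (ratr (t * d))%:P) s t t0 inj_s _ z.
  rewrite (meval_eq _ (horner_pt4 _ _ _ _ _)) !hornerE; apply=> m.
  rewrite (meval_eq _ (horner_pt4 _ _ _ _ _)) !hornerE.
  by have [l /good_swap34/h1->] := gs m.
have h3 (t : rat) k a b c d : t != 0 -> good k a b c d -> forall y z w : algC,
    h.@[pt4 (ratr (t * a)) y z w] = 0.
  move=> t0 /good_infinite[s [inj_s gs]] y z w.
  have := @meval_line_eq0 _ h (pt4 (ratr (t * a))%:P y%:P z%:P 'X) s t t0 inj_s _ w.
  rewrite (meval_eq _ (horner_pt4 _ _ _ _ _)) !hornerE; apply=> m.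
  rewrite (meval_eq _ (horner_pt4 _ _ _ _ _)) !hornerE.
  by have [l /h2->] := gs m.
move=> v; rewrite (meval_eq _ (pt4E v)).
move: (v (inord 0)) (v (inord 1)) (v (inord 2)) (v (inord 3)) => x y z w.
(* The starting point has first coordinate 9; scaling it by n + 1 gives infinitely many first
   coordinates. *)
have := @meval_line_eq0 _ h (pt4 'X y%:P z%:P w%:P) (fun n => n.+1%:R) 9 isT _ _ x.
rewrite (meval_eq _ (horner_pt4 _ _ _ _ _)) !hornerE; apply=> [i j /eqP|m].
  by rewrite eqr_nat => /eqP[].
rewrite (meval_eq _ (horner_pt4 _ _ _ _ _)) !hornerE mulrC.
by rewrite (h3 _ _ _ _ _ _ _ good_start) // pnatr_eq0.
Qed.

(** Homogeneity as a property of values passes to the permuted form [msym] by evaluation alone. *)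
Definition homogeneous_on_points d (g : {mpoly algC[5.+1 + 0]}) :=
  forall t v, g.@[fun i => t * v i] = t ^+ d * g.@[v].

(* Keeping the coordinates nonzero also yields the density of the domain of psi. *)
Definition torus_rational_points (P : ppoint 5 0) :=
  rational_points Bprime P /\ forall k, P.1 0 k != 0.

Definition seqpt (R : pzRingType) (s : seq R) : 'rV[R]_6 * 'rV[R]_0 :=
  (\row_i s`_i, 0).

Lemma xc_seqpt (s : seq algC) k : (k < 6)%N -> xc (seqpt s) k = s`_k.
Proof. by move=> k6; rewrite /xc mxE inordK. Qed.

(** The first two coordinates are the roots (- e1 e2 + w) / (2 e2) and (- e1 e2 - w) / (2 e2) of the
    quadratic for x1 and x2; the whole point is scaled by 2 e2 to clear denominators. *)
Definition lifts (R : comNzRingType) (w a b c d : R) : seq R :=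
  let E := esym1 a b c d * esym2 a b c d in let e := 2%:R * esym2 a b c d in
  [:: w - E; - w - E; e * a; e * b; e * c; e * d].

Lemma map_lifts (R S : comNzRingType) (f : {rmorphism R -> S}) w a b c d :
  map f (lifts w a b c d) = lifts (f w) (f a) (f b) (f c) (f d).
Proof.
rewrite /lifts -rmorph_esym1 -rmorph_esym2 /=.
by rewrite !(rmorphB, rmorphN, rmorphM, rmorph_nat).
Qed.

Lemma lifts_Bprime (w a b c d : algC) : w ^+ 2 = branch a b c d ->
  [&& esym2 a b c d != 0 & a != 0] -> Bprime (seqpt (lifts w a b c d)).
Proof.
move=> hw /andP[e0 a0]; apply/BprimeE; rewrite !xc_seqpt //=; split.
- apply/eqP => /rowP/(_ (inord 2)); rewrite !mxE inordK //= => /eqP.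
  by rewrite !mulf_eq0 pnatr_eq0 (negPf e0) (negPf a0).
- by rewrite /esym1 /esym2; ring.
- have -> : forall E, (w - E) * (- w - E) = E ^+ 2 - w ^+ 2 by move=> E; ring.
  by rewrite hw /branch /esym1 /esym2 /esym3 /esym4; ring.
Qed.

(** On B' this is e2 x1 x2, which controls the vanishing of the first two coordinates. *)
Definition lift_prod (R : comNzRingType) (a b c d : R) :=
  esym1 a b c d * esym3 a b c d - esym4 a b c d.

Lemma rmorph_lift_prod (R S : comNzRingType) (f : {rmorphism R -> S}) a b c d :
  f (lift_prod a b c d) = lift_prod (f a) (f b) (f c) (f d).
Proof.
rewrite /lift_prod -rmorph_esym1 -rmorph_esym3 -rmorph_esym4.
move: (esym1 _ _ _ _) (esym3 _ _ _ _) (esym4 _ _ _ _) => p q r.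
by rewrite rmorphB rmorphM.
Qed.

Lemma lifts_torus k (t a b c d w : rat) : t != 0 -> good k a b c d ->
  lift_prod (t * a) (t * b) (t * c) (t * d) != 0 ->
  w ^+ 2 = branch (t * a) (t * b) (t * c) (t * d) ->
  torus_rational_points (seqpt (lifts (ratr w : algC)
    (ratr (t * a)) (ratr (t * b)) (ratr (t * c)) (ratr (t * d)))).
Proof.
move=> t0 g p0 hw; have [_ e0] := branch_neq0 g.
case: g => [[/unit2_neq0 a0 /unit2_neq0 b0] [/unit2_neq0 c0 /unit2_neq0 d0] _ _].
have e1 : esym2 (t * a) (t * b) (t * c) (t * d) != 0.
  have -> : esym2 (t * a) (t * b) (t * c) (t * d) = t ^+ 2 * esym2 a b c d.
    by rewrite /esym2; ring.
  by rewrite mulf_neq0 ?expf_neq0.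
have [ta tb tc td] : [/\ t * a != 0, t * b != 0, t * c != 0 & t * d != 0].
  by split; rewrite mulf_neq0.
move: (t * a) (t * b) (t * c) (t * d) p0 hw e1 ta tb tc td
  => {a0 b0 c0 d0 e0} {}a {}b {}c {}d p0 hw e0 a0 b0 c0 d0.
have E : lifts (ratr w : algC) (ratr a) (ratr b) (ratr c) (ratr d)
    = map ratr (lifts w a b c d).
  by rewrite map_lifts.
have nz : all (fun x => x != 0) (lifts w a b c d).
  (* The first two coordinates are treated together through their product E^2 - w^2. *)
  rewrite /= !mulf_neq0 ?pnatr_eq0 // !andbT -negb_or -mulf_eq0.
  have -> : forall E, (w - E) * (- w - E) = E ^+ 2 - w ^+ 2 by move=> z; ring.
  have -> : (esym1 a b c d * esym2 a b c d) ^+ 2 - w ^+ 2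
      = 4%:R * esym2 a b c d * lift_prod a b c d.
    by rewrite hw /branch /lift_prod; ring.
  by rewrite !mulf_neq0 ?pnatr_eq0.
split; last first.
  move=> k'; rewrite mxE E (nth_map 0) ?fmorph_eq0; last by case: k'.
  by apply: (allP nz); rewrite mem_nth //; case: k'.
split.
  apply: lifts_Bprime.
    by rewrite -rmorphXn hw rmorph_branch.
  by rewrite -rmorph_esym2 !fmorph_eq0 e0 a0.
exists (\row_i (lifts w a b c d)`_i), 0; split.
  by rewrite map_mx0.
exists 1; first exact: oner_neq0.
apply/rowP => i; rewrite !mxE mul1r E (nth_map 0) //; by case: i.
Qed.

Lemma lift_prod_mevalE (v : 'I_4 -> algC) :
  (lift_prod 'X_(inord 0) 'X_(inord 1) 'X_(inord 2) 'X_(inord 3) : {mpoly algC[4]}).@[v]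
  = lift_prod (v (inord 0)) (v (inord 1)) (v (inord 2)) (v (inord 3)).
Proof.
by rewrite rmorph_lift_prod /= !mevalXU.
Qed.

(** Pulled back along [lifts], the form [g] becomes A + w B. Both signs of w occur at good points,
    so A and B vanish there and hence identically; and [P] is itself a lift up to scaling. *)
Lemma Bprime_vanishing d g P : homogeneous_on_points d g ->
  (forall Q, torus_rational_points Q -> g.@[coords Q] = 0) -> Bprime P ->
  esym2 (xc P 2) (xc P 3) (xc P 4) (xc P 5) != 0 -> g.@[coords P] = 0.
Proof.
move=> hom_g g0 /BprimeE[_ P1 P4] e0.
pose X (i : nat) : {mpoly algC[4]} := 'X_(inord i).
pose c (i : 'I_(6 + 0)) :=
  (lifts 'X (X 0)%:P (X 1)%:P (X 2%N)%:P (X 3%N)%:P)`_i.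
pose D := branch (X 0) (X 1) (X 2%N) (X 3%N).
have [A [B AB]] := mpoly_quadratic_split g c D.
have {}AB w x y z t : w ^+ 2 = branch x y z t ->
    g.@[fun i => (lifts w x y z t)`_i] = A.@[pt4 x y z t] + w * B.@[pt4 x y z t].
  move=> hw; set v := pt4 x y z t.
  have [v0 v1 v2 v3] : [/\ v (inord 0) = x, v (inord 1) = y, v (inord 2) = z
                         & v (inord 3) = t] by rewrite /v /pt4 !inordK.
  rewrite -AB; last by rewrite hw rmorph_branch /= !mevalXU v0 v1 v2 v3.
  apply: meval_eq => i.
  pose f := (horner_eval w \o map_poly (meval v)) :
    {rmorphism {poly {mpoly algC[4]}} -> algC}.
  have -> : (map_poly (meval v) (c i)).[w] = f (c i) by [].
  rewrite /c -(nth_map _ 0) ?map_lifts; last by apply: (ltn_ord i).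
  by rewrite /f /= /horner_eval map_polyX !map_polyC /= !mevalXU hornerX !hornerC v0 v1 v2 v3.
(* Multiplying by [q] covers the good points whose lift leaves the torus; [q] is cancelled later
   because it equals 15 at (1, 1, 1, 1). *)
pose q := lift_prod (X 0) (X 1) (X 2%N) (X 3%N).
have q1 : q.@[fun=> 1] != 0.
  rewrite lift_prod_mevalE /lift_prod /esym1 /esym3 /esym4.
  have -> : (1 + 1 + 1 + 1) * (1 * 1 * 1 + 1 * 1 * 1 + 1 * 1 * 1 + 1 * 1 * 1)
    - 1 * 1 * 1 * 1 = 15%:R :> algC by ring.
  by rewrite pnatr_eq0.
have AB0 (t : rat) k a b e f : t != 0 -> good k a b e f ->
    let v := pt4 (ratr (t * a)) (ratr (t * b)) (ratr (t * e)) (ratr (t * f)) in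
    (A * q).@[v] = 0 /\ (B * q).@[v] = 0.
  move=> t0 gd v; rewrite !mevalM lift_prod_mevalE /v /pt4 !inordK //= -/(pt4 _ _ _ _).
  have -> : lift_prod (ratr (t * a)) (ratr (t * b)) (ratr (t * e)) (ratr (t * f))
      = ratr (lift_prod (t * a) (t * b) (t * e) (t * f)) :> algC.
    by rewrite rmorph_lift_prod.
  have [->|p0] := eqVneq (lift_prod (t * a) (t * b) (t * e) (t * f)) 0.
    by rewrite rmorph0 !mulr0.
  have [[D0 _] [_ _ _ [w0 hw0]]] := (branch_neq0 gd, gd).
  (* [branch] has degree 6, so scaling by t multiplies its square root by t^3. *)
  have bE : branch (t * a) (t * b) (t * e) (t * f) = t ^+ 6 * branch a b e f.
    by rewrite /branch /esym1 /esym2 /esym3 /esym4; ring.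
  pose w := t ^+ 3 * w0.
  have hw : w ^+ 2 = branch (t * a) (t * b) (t * e) (t * f).
    by rewrite bE hw0 /w exprMn -exprM.
  have w_neq0 : w != 0.
    have : w ^+ 2 != 0 by rewrite hw bE mulf_neq0 ?expf_neq0.
    by rewrite expf_eq0.
  have hwC : (ratr w : algC) ^+ 2 =
      branch (ratr (t * a)) (ratr (t * b)) (ratr (t * e)) (ratr (t * f)).
    by rewrite -rmorphXn hw rmorph_branch.
  have zero w' : w' ^+ 2 = branch (t * a) (t * b) (t * e) (t * f) ->
     A.@[v] + ratr w' * B.@[v] = 0.
    move=> hw'; rewrite -AB; last by rewrite -rmorphXn hw' rmorph_branch.
    apply: etrans (g0 _ (lifts_torus t0 gd p0 hw')); apply: meval_eq => i.
    by rewrite coords_xc xc_seqpt //; apply: (ltn_ord i).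
  have z1 := zero _ hw; have := zero (- w); rewrite sqrrN => /(_ hw).
  rewrite rmorphN mulNr => z2.
  have A0 : A.@[v] = 0.
    apply: (@mulfI _ 2%:R); first by rewrite pnatr_eq0.
    have -> : 2%:R * A.@[v] = (A.@[v] + ratr w * B.@[v]) + (A.@[v] - ratr w * B.@[v]).
      by ring.
    by rewrite z1 z2 addr0 mulr0.
  split; rewrite ?A0 ?mul0r //.
  move: z1; rewrite A0 add0r => /eqP.
  by rewrite mulf_eq0 fmorph_eq0 (negPf w_neq0) => /eqP ->; rewrite mul0r.
have A0 : forall v, A.@[v] = 0.
  apply: (meval_cancel _ q1) => v; rewrite -mevalM; apply: good_dense.
  by move=> t k a b e f t0 gd; have [] := AB0 _ _ _ _ _ _ t0 gd.
have B0 : forall v, B.@[v] = 0.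
  apply: (meval_cancel _ q1) => v; rewrite -mevalM; apply: good_dense.
  by move=> t k a b e f t0 gd; have [] := AB0 _ _ _ _ _ _ t0 gd.
set a := xc P 2 in P1 P4 e0; set b := xc P 3 in P1 P4 e0.
set x := xc P 4 in P1 P4 e0; set y := xc P 5 in P1 P4 e0.
set e2 := esym2 a b x y in e0 P4.
(* With this root, the lift of the last four coordinates is 2 e2 times [P]. *)
pose w := e2 * (xc P 0 - xc P 1).
have s01 : xc P 0 + xc P 1 = - esym1 a b x y by apply/eqP; rewrite -addr_eq0 P1.
have hw : w ^+ 2 = branch a b x y.
  have -> : w ^+ 2 = e2 * ((xc P 0 + xc P 1) ^+ 2 * e2 - 4%:R * (xc P 0 * xc P 1 * e2)).
    by rewrite /w; ring.
  have -> : xc P 0 * xc P 1 * e2 = esym1 a b x y * esym3 a b x y - esym4 a b x y.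
    by apply/eqP; rewrite -subr_eq0 -P4 s01; apply/eqP; ring.
  by rewrite s01 /branch -/e2; ring.
have := AB _ _ _ _ _ hw; rewrite A0 B0 mulr0 addr0.
rewrite (_ : g.@[_] = g.@[fun i => 2%:R * e2 * coords P i]); last first.
  apply: meval_eq => i; rewrite coords_xc.
  have e1 : esym1 a b x y = - (xc P 0 + xc P 1) by rewrite s01 opprK.
  rewrite /lifts e1 -/e2 /w.
  by case: i => [[|[|[|[|[|[|]]]]]]] //= _; ring.
by move=> /eqP; rewrite hom_g mulf_eq0 expf_eq0 !mulf_eq0 pnatr_eq0 (negPf e0) andbF => /eqP.
Qed.

Lemma xhomog_scale n m d (g : {mpoly algC[n.+1 + m]}) (P : ppoint n m) t :
  xhomog d g -> g.@[coords (t *: P.1, P.2)] = t ^+ d * g.@[coords P].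
Proof.
move=> /allP hg; rewrite !mevalE mulr_sumr; apply: eq_big_seq => mon /hg/eqP <-.
rewrite mulrCA; congr (_ * _); rewrite !big_split_ord /= mulrA; congr (_ * _).
  rewrite -prodrXr -big_split; apply: eq_bigr => i _ /=.
  by rewrite /coords !row_mxEl mxE exprMn.
by apply: eq_bigr => i _; rewrite /coords !row_mxEr.
Qed.

Lemma coords_surj n m (v : 'I_(n.+1 + m) -> algC) :
  coords (\row_i v (lshift m i), \row_j v (rshift n.+1 j)) =1 v.
Proof.
move=> i; rewrite /coords -[i]splitK.
by case: (split i) => j; rewrite (row_mxEl, row_mxEr) mxE.
Qed.

Lemma xhomog_on_points d (g : {mpoly algC[5.+1 + 0]}) :
  xhomog d g -> homogeneous_on_points d g.
Proof.
move=> hg t v; rewrite -(meval_eq _ (coords_surj v)) -xhomog_scale //.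
apply: meval_eq => i; rewrite -(@coords_surj 5 0 (fun i => t * v i)).
by congr coords; congr pair; apply/rowP => j; rewrite !mxE //; case: j.
Qed.

(** * Permutations of the coordinates of B' *)

Section Permutation.
Variable s : 'S_6.

Definition permute (P : ppoint 5 0) : ppoint 5 0 := (col_perm s P.1, P.2).

Lemma coords_permute P i : coords (permute P) i = coords P ((s : 'S_(6 + 0)) i).
Proof.
rewrite !coords_xc /xc mxE; congr (P.1 0 _); rewrite inord_val.
by apply/val_inj; rewrite /= inordK //; congr (nat_of_ord (s _)); apply/val_inj.
Qed.

Lemma xc_permute P k : xc (permute P) k = P.1 0 (s (inord k)).
Proof. by rewrite /xc mxE. Qed.

Lemma meval_permute (p : {mpoly algC[6 + 0]}) P :
  p.@[coords (permute P)] = (msym (s : 'S_(6 + 0)) p).@[coords P].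
Proof.
by rewrite meval_mmapC; apply: meval_eq => i; rewrite mevalXU coords_permute.
Qed.

Lemma Bprime_permute P : Bprime P -> Bprime (permute P).
Proof.
move=> [P0 h]; split.
  apply: contraNneq P0 => /rowP e; apply/eqP/rowP => i.
  by have := e ((s^-1)%g i); rewrite !mxE permKV.
move=> p hp; rewrite -[RHS](h p hp); move: hp; rewrite !inE.
by case/orP => /eqP ->; rewrite /evalQ map_mesym meval_permute;
  rewrite (issymP _ (mesym_sym _ _ _)).
Qed.

Lemma torus_permute P : torus_rational_points P -> torus_rational_points (permute P).
Proof.
move=> [[hP [x [y [e2 [t t0 e1]]]]] nz]; split; last by move=> k; rewrite mxE.
split; first exact: Bprime_permute.
exists (col_perm s x), y; split=> //; exists t => //=.
rewrite /= in e1; apply/rowP => i; rewrite !mxE; have /rowP/(_ (s i)) := e1.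
by rewrite !mxE.
Qed.

End Permutation.

(** The full power sum does not depend on which pair is singled out, so the conditions e2 = 0 for
    different pairs can be compared. *)
Lemma esym2_power_sum (R : comNzRingType) (a b c d e f : R) :
  a + b + esym1 c d e f = 0 -> 2%:R * esym2 c d e f =
  2%:R * (a ^+ 2 + a * b + b ^+ 2) - (a ^+ 2 + b ^+ 2 + c ^+ 2 + d ^+ 2 + e ^+ 2 + f ^+ 2).
Proof.
move=> h; have -> : 2%:R * esym2 c d e f
    = (esym1 c d e f) ^+ 2 - (c ^+ 2 + d ^+ 2 + e ^+ 2 + f ^+ 2).
  by rewrite /esym1 /esym2; ring.
have -> : esym1 c d e f = - (a + b) by apply/eqP; rewrite -addr_eq0 addrC h.
by ring.
Qed.

(** Subtracting the conditions for {i, k} and {i, i0} gives (x_k - x_i0) (x_i + x_k + x_i0) = 0. If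
    x_k and x_i0 differ, the other four coordinates equal - (x_k + x_i0). The zero sum makes them 0,
    and then x_k = x_i0 = 0, a contradiction. So all coordinates are equal, hence 0. *)
Lemma pair_forms_eq0 (x : 'I_6 -> algC) : \sum_i x i = 0 ->
  (forall i j, i != j ->
     2%:R * (x i ^+ 2 + x i * x j + x j ^+ 2) = \sum_i x i ^+ 2) ->
  forall i, x i = 0.
Proof.
move=> s0 hx; pose i0 : 'I_6 := ord0.
have diff k i : k != i0 -> x k != x i0 -> i != i0 -> i != k -> x i = - (x k + x i0).
  move=> k0 xk ii0 ik; apply/eqP; rewrite -addr_eq0.
  have := hx i k ik; rewrite -(hx i i0 ii0) => /mulfI/eqP.
  rewrite pnatr_eq0 => /(_ isT); rewrite -subr_eq0.
  have -> : x i ^+ 2 + x i * x k + x k ^+ 2 - (x i ^+ 2 + x i * x i0 + x i0 ^+ 2)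
    = (x k - x i0) * (x i + (x k + x i0)) by ring.
  by rewrite mulf_eq0 subr_eq0 (negPf xk).
have eq_all k : x k = x i0.
  have [-> //|k0] := eqVneq k i0; apply/eqP/negPn/negP => xk.
  have card4 : #|[pred i : 'I_6 | (i != i0) && (i != k)]| = 4.
    have -> : #|[pred i : 'I_6 | (i != i0) && (i != k)]| = #|~: [set i0; k]|.
      by apply: eq_card => i; rewrite !inE negb_or.
    by rewrite cardsCs setCK cards2 card_ord eq_sym k0.
  have {}diff i : (i != i0) && (i != k) -> x i = - (x k + x i0).
    by case/andP=> ii0 ik; apply: diff.
  have r0 : x k + x i0 = 0.
    move: s0; rewrite (bigD1 i0) //= (bigD1 k) //=.
    rewrite (eq_bigr (fun=> - (x k + x i0))) // sumr_const card4.
    have -> : x i0 + (x k + - (x k + x i0) *+ 4) = - 3%:R * (x k + x i0) by ring.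
    by move=> /eqP; rewrite mulf_eq0 oppr_eq0 pnatr_eq0 => /eqP.
  have /card_gt1P[i [j [hi hj ij]]] : (1 < #|[pred i : 'I_6 | (i != i0) && (i != k)]|)%N.
    by rewrite card4.
  have := hx k i0 k0; rewrite -(hx i j ij) (diff i hi) (diff j hj) r0 oppr0.
  have -> : x i0 = - x k by apply/eqP; rewrite -addr_eq0 addrC r0.
  have -> : 2%:R * (x k ^+ 2 + x k * - x k + (- x k) ^+ 2) = 2%:R * x k ^+ 2 by ring.
  rewrite expr0n /= !(mulr0, addr0) => /eqP; rewrite mulf_eq0 pnatr_eq0 expf_eq0 /=.
  move=> /eqP xk0; move: xk; rewrite xk0; have /eqP := r0.
  by rewrite xk0 add0r => /eqP ->; rewrite eqxx.
move=> k; rewrite eq_all; move: s0; rewrite (eq_bigr (fun=> x i0)) //.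
by rewrite sumr_const card_ord => /eqP; rewrite mulrn_eq0 => /eqP.
Qed.

(** If [g] did not vanish at [P], moving any pair of coordinates to the front would force e2 = 0 for
    the remaining four, and [pair_forms_eq0] would give [P] zero coordinates. *)
Lemma torus_dense d g : xhomog d g ->
  (forall Q, torus_rational_points Q -> g.@[coords Q] = 0) ->
  forall P, Bprime P -> g.@[coords P] = 0.
Proof.
move=> hom_g g0 P hP; apply/eqP/negPn/negP => gP.
have [P0 P1 _] := (BprimeE P).1 hP; pose x i := P.1 0 i.
have sum6 (f : 'I_6 -> algC) : \sum_i f i =
    f (inord 0) + f (inord 1) + f (inord 2) + f (inord 3) + f (inord 4) + f (inord 5).
  do 6![rewrite big_ord_recr /=]; rewrite big_ord0 add0r.
  by do ![congr (_ + _)]; congr f; apply/val_inj; rewrite /= inordK.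
have s0 : \sum_i x i = 0 by rewrite sum6 -P1 /xc /x /esym1 !addrA.
have xs0 (s : 'S_6) (f : algC -> algC) : \sum_i f (x (s i)) = \sum_i f (x i).
  by rewrite [RHS](reindex_perm s).
have xcE (s : 'S_6) k : xc (permute s P) k = x (s (inord k)) by rewrite xc_permute.
case/eqP: P0; apply/rowP => k; rewrite mxE; apply: (pair_forms_eq0 s0) => i j ij.
(* This permutation sends positions 0 and 1 to [i] and [j]. *)
pose s : 'S_6 := (tperm (tperm (inord 0) i j) (inord 1) * tperm (inord 0) i)%g.
have n01 : (inord 0 : 'I_6) != inord 1 by rewrite -val_eqE /= !inordK.
have s1 : s (inord 1) = j by rewrite permM tpermR tpermK.
have n0 : tperm (inord 0) i j != inord 0.
  rewrite -[X in _ != X](tpermR (inord 0) i) (inj_eq perm_inj) eq_sym //.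
have s0i : s (inord 0) = i by rewrite permM (tpermD n0) 1?eq_sym // tpermL.
have h : 2%:R * esym2 (x (s (inord 2))) (x (s (inord 3))) (x (s (inord 4))) (x (s (inord 5)))
    = 2%:R * (x i ^+ 2 + x i * x j + x j ^+ 2) - \sum_i x i ^+ 2.
  rewrite -(xs0 s (fun y => y ^+ 2)) sum6 s0i s1 -esym2_power_sum //.
  by rewrite -s0i -s1 -s0 -[RHS](xs0 s id) sum6 /esym1 !addrA.
apply/eqP; rewrite -subr_eq0 -h mulf_eq0 pnatr_eq0 /=; apply: contraNT gP => e0.
have pP : coords P =1 coords (permute s^-1 (permute s P)).
  by move=> l; rewrite !coords_permute permKV.
rewrite (meval_eq _ pP) meval_permute (@Bprime_vanishing d) //.
- move=> t v; rewrite !meval_mmapC -xhomog_on_points //.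
  by apply: meval_eq => l; rewrite !mevalXU.
- by move=> Q /(torus_permute s^-1); rewrite -meval_permute; apply: g0.
- exact: Bprime_permute.
- by rewrite !xcE.
Qed.

Lemma Bprime_rational_dense : zariski_dense (rational_points Bprime) Bprime.
Proof.
split=> [P [] //|d g hg g0 P hP].
by apply: (torus_dense hg) hP => Q [hQ _]; apply: g0.
Qed.

(** * Points of the elliptic threefold at infinity *)

Lemma quadratic_roots (a b c : algC) : a != 0 -> b ^+ 2 - 4%:R * a * c != 0 ->
  exists x y, [/\ x != y, a * x ^+ 2 + b * x + c = 0 & a * y ^+ 2 + b * y + c = 0].
Proof.
move=> a0 d0; pose s := sqrtC (b ^+ 2 - 4%:R * a * c).
have hs : s ^+ 2 = b ^+ 2 - 4%:R * a * c by rewrite sqrtCK.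
have a2 : 2%:R * a != 0 by rewrite mulf_neq0 ?pnatr_eq0.
exists ((- b + s) / (2%:R * a)), ((- b - s) / (2%:R * a)); split.
- rewrite -subr_eq0 -mulrBl mulf_neq0 ?invr_neq0 //.
  have -> : - b + s - (- b - s) = 2%:R * s by ring.
  by rewrite mulf_neq0 ?pnatr_eq0 // sqrtC_eq0.
- have -> : a * ((- b + s) / (2%:R * a)) ^+ 2 + b * ((- b + s) / (2%:R * a)) + c
      = (s ^+ 2 - (b ^+ 2 - 4%:R * a * c)) / (4%:R * a) by field.
  by rewrite hs subrr mul0r.
- have -> : a * ((- b - s) / (2%:R * a)) ^+ 2 + b * ((- b - s) / (2%:R * a)) + c
      = (s ^+ 2 - (b ^+ 2 - 4%:R * a * c)) / (4%:R * a) by field.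
  by rewrite hs subrr mul0r.
Qed.

(* Divide G by the quadratic: the remainder vanishes at the two roots for almost
   every z, hence identically. *)
Lemma quadratic_specialization (a b c : {poly algC}) (G : {poly {poly algC}}) :
  (forall z x, z != 0 -> a.[z] * x ^+ 2 + b.[z] * x + c.[z] = 0 ->
     G.[x%:P].[z] = 0) ->
  a.[0] != 0 -> b.[0] ^+ 2 - 4%:R * a.[0] * c.[0] != 0 ->
  forall x, a.[0] * x ^+ 2 + b.[0] * x + c.[0] = 0 -> G.[x%:P].[0] = 0.
Proof.
move=> hG a0 d0 x hx.
have nz : a != 0 by apply: contraNneq a0 => ->; rewrite horner0.
pose F : {poly {poly algC}} := Poly [:: c; b; a].
have FE : F = a%:P * 'X^2 + b%:P * 'X + c%:P.
  by rewrite /F /= !cons_poly_def; ring.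
have sF : size F = 3 by rewrite /F (PolyK (c := 0)).
have lF : lead_coef F = a by rewrite lead_coefE sF /F (PolyK (c := 0)).
have F0 : F != 0 by rewrite -size_poly_eq0 sF.
have Fev z y : F.[y%:P].[z] = a.[z] * y ^+ 2 + b.[z] * y + c.[z].
  by rewrite FE !hornerE.
pose r := (G %% F)%R.
have := Pdiv.Idomain.divp_eq G F; rewrite lF -/r.
set k := scalp _ _; set q := (_ %/ _)%R => hdiv.
have hev z y : a.[z] ^+ k * G.[y%:P].[z] = q.[y%:P].[z] * F.[y%:P].[z] + r.[y%:P].[z].
  have := congr1 (fun p => p.[y%:P].[z]) hdiv.
  by rewrite hornerZ !hornerE.
have sr : (size r <= 2)%N by have := ltn_modp G F; rewrite F0 sF.
have rE z y : r.[y%:P].[z] = (r`_0).[z] + (r`_1).[z] * y.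
  have {1}-> : r = (r`_0)%:P + (r`_1)%:P * 'X.
    apply/polyP => i; rewrite coefD coefC coefMX coefC.
    case: i => [|[|i]] //=; rewrite ?addr0 ?add0r //.
    by rewrite nth_default // (leq_trans sr).
  by rewrite !hornerE.
(* Off the zeros of [bad] the quadratic has two distinct roots and z is nonzero, so the linear
   remainder vanishes there. *)
pose bad := 'X * a * (b ^+ 2 - 4%:R *: a * c).
have badE z : bad.[z] = z * a.[z] * (b.[z] ^+ 2 - 4%:R * a.[z] * c.[z]).
  by rewrite /bad !hornerM hornerX hornerD hornerN !hornerM hornerZ.
have r0 z : (r`_0).[z] * bad.[z] = 0 /\ (r`_1).[z] * bad.[z] = 0.
  have [-> | z0] := eqVneq z 0; first by rewrite badE !mul0r !mulr0.
  have [az | az] := eqVneq a.[z] 0.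
    by rewrite badE az mulr0 mul0r !mulr0.
  have [dz | dz] := eqVneq (b.[z] ^+ 2 - 4%:R * a.[z] * c.[z]) 0.
    by rewrite badE dz !mulr0.
  have [y1 [y2 [y12 h1 h2]]] := quadratic_roots az dz.
  have e1 := hev z y1; have e2 := hev z y2.
  rewrite !Fev !rE h1 (hG _ _ z0 h1) mulr0 mulr0 add0r in e1.
  rewrite !Fev !rE h2 (hG _ _ z0 h2) mulr0 mulr0 add0r in e2.
  have r1z : (r`_1).[z] = 0.
    have : (r`_1).[z] * (y1 - y2) = 0.
      have -> : (r`_1).[z] * (y1 - y2)
          = ((r`_0).[z] + (r`_1).[z] * y1) - ((r`_0).[z] + (r`_1).[z] * y2).
        by ring.
      by rewrite -e1 -e2 subrr.
    by move=> /eqP; rewrite mulf_eq0 subr_eq0 (negPf y12) orbF => /eqP.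
  by move: e1; rewrite r1z mul0r addr0 => <-; rewrite !mul0r.
have bad0 : bad != 0.
  have : a * (b ^+ 2 - 4%:R *: a * c) != 0.
    apply: contraTneq isT => /(congr1 (fun p => p.[0])).
    by rewrite !hornerE => /eqP; rewrite mulf_eq0 (negPf a0) (negPf d0).
  by move=> h; rewrite /bad -(mulrA 'X) mulf_neq0 ?polyX_eq0.
have vanish p : (forall z, p.[z] * bad.[z] = 0) -> p = 0.
  move=> h; have : p * bad = 0.
    apply: (@poly_eq0_infinite _ _ (fun n => n%:R)) => [i j /eqP|i].
      by rewrite eqr_nat => /eqP.
    by rewrite hornerM h.
  by move=> /eqP; rewrite mulf_eq0 (negPf bad0) orbF => /eqP.
have := hev 0 x; rewrite Fev hx rE.
rewrite (vanish _ (fun z => (r0 z).1)) (vanish _ (fun z => (r0 z).2)) horner0.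
rewrite mulr0 mul0r !addr0 => /eqP.
by rewrite mulf_eq0 expf_eq0 (negPf a0) andbF => /eqP.
Qed.

Lemma rmorph_cubic_form (R S : comNzRingType) (f : {rmorphism R -> S}) u v X Y Z :
  f (cubic_form u v X Y Z) = cubic_form (f u) (f v) (f X) (f Y) (f Z).
Proof.
by rewrite /cubic_form !(rmorphD, rmorphN, rmorphM, rmorph1, rmorph_nat).
Qed.

Definition pt5 (X Y Z u v : algC) : ppoint 2 2 :=
  (\row_i [:: X; Y; Z]`_i, \row_j [:: u; v]`_j).

Lemma pt5P (P : ppoint 2 2) : exists X Y Z u v, P = pt5 X Y Z u v.
Proof.
case: P => x y; exists (x 0 (inord 0)), (x 0 (inord 1)), (x 0 (inord 2)).
exists (y 0 (inord 0)), (y 0 (inord 1)); congr pair; apply/rowP => i; rewrite mxE.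
  by case: i => [[|[|[|]]]] //= p; congr (x 0 _); apply/val_inj; rewrite /= inordK.
by case: i => [[|[|]]] //= p; congr (y 0 _); apply/val_inj; rewrite /= inordK.
Qed.

Lemma coords_pt5 X Y Z u v :
  coords (pt5 X Y Z u v) =1 fun i => [:: X; Y; Z; u; v]`_i.
Proof.
move=> i; rewrite /coords -[i]splitK; case: (split i) => j.
  by rewrite row_mxEl mxE; case: j => [[|[|[|]]]].
by rewrite row_mxEr mxE; case: j => [[|[|]]].
Qed.

Lemma evalQ_rmorph n m (P : ppoint n m) :
  exists f : {rmorphism {mpoly rat[n.+1 + m]} -> algC},
    f =1 (fun p => evalQ p P) /\ forall i, f 'X_i = coords P i.
Proof.
exists (meval (coords P) \o map_mpoly ratr); split=> // i /=.
by rewrite map_mpolyX mevalXU.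
Qed.

Lemma pt5_var X Y Z u v :
  let P := pt5 X Y Z u v in
  [/\ evalQ PX P = X, evalQ PY P = Y & evalQ PZ P = Z] /\
  evalQ Pu P = u /\ evalQ Pv P = v.
Proof.
move=> P; have [f [fE fX]] := evalQ_rmorph P.
by do ![split]; rewrite -fE fX coords_pt5 /= inordK.
Qed.

Lemma pt5_neq0 X Y Z u v :
  (pt5 X Y Z u v).1 != 0 <-> [|| X != 0, Y != 0 | Z != 0].
Proof.
split; last first.
  apply: contraTneq => /rowP e; rewrite !negb_or !negbK.
  have := e (inord 0); have := e (inord 1); have := e (inord 2).
  by rewrite !mxE !inordK //= => -> -> ->; rewrite eqxx.
apply: contraNT; rewrite !negb_or !negbK => /and3P[/eqP-> /eqP-> /eqP->].
by apply/eqP/rowP => i; rewrite !mxE; case: i => [[|[|[|]]]].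
Qed.

Lemma threefold_pt5 X Y Z u v : elliptic_threefold (pt5 X Y Z u v) <->
  [|| X != 0, Y != 0 | Z != 0] /\ cubic_form u v X Y Z = 0.
Proof.
have [[hX hY hZ] [hu hv]] := pt5_var X Y Z u v.
have [f [fE _]] := evalQ_rmorph (pt5 X Y Z u v).
have e : evalQ (cubic_form Pu Pv PX PY PZ) (pt5 X Y Z u v) = cubic_form u v X Y Z.
  by rewrite -fE rmorph_cubic_form !fE hX hY hZ hu hv.
split=> [[/pt5_neq0 P0 h]|[P0 h]]; split=> //; first by rewrite -e h ?inE.
  exact/pt5_neq0.
by move=> p; rewrite inE => /eqP ->; rewrite e.
Qed.

Lemma cubic_formC (R : comNzRingType) (u v X Y Z : R) :
  cubic_form u v X Y Z = cubic_form u v Y X Z.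
Proof. by rewrite /cubic_form; ring. Qed.

(* For u + v != 1 the points at infinity (X : y : 0), X != 0, are limits of
   finite points of the same cubic. *)
Lemma cubic_infinity_limit (u v X : algC) (G : {poly {poly algC}}) :
  u + v != 1 -> X != 0 ->
  (forall z y, z != 0 -> cubic_form u v X y z = 0 -> G.[y%:P].[z] = 0) ->
  forall y, y * (X + y) = 0 -> G.[y%:P].[0] = 0.
Proof.
rewrite -subr_eq0; set c := u + v - 1 => c0 X0 hG y hy.
pose b := - (u * v) + u + v.
pose d := - u ^+ 2 - 3%:R * u * v + 3%:R * u - v ^+ 2 + 3%:R * v - 1.
pose e := u ^+ 2 * v + u * v ^+ 2 - u * v.
pose f := u ^+ 2 * v - u ^+ 2 + u * v ^+ 2 - 3%:R * u * v + u - v ^+ 2 + v.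
(* The cubic is a quadratic in Y with coefficients polynomial in Z. At Z = 0 it is c X (Y^2 + X Y),
   with distinct roots 0 and - X. *)
pose p2 : {poly algC} := (c * X)%:P + b *: 'X.
pose p1 : {poly algC} := (c * X ^+ 2)%:P + (d * X) *: 'X + f *: 'X^2.
pose p0 : {poly algC} := (b * X ^+ 2) *: 'X + e *: 'X^3 + (f * X) *: 'X^2.
have pE z t : p2.[z] * t ^+ 2 + p1.[z] * t + p0.[z] = cubic_form u v X t z.
  rewrite /p2 /p1 /p0 !(hornerD, hornerZ, hornerX, hornerXn, hornerC).
  by rewrite /cubic_form /b /c /d /e /f; ring.
have p20 : p2.[0] = c * X.
  by rewrite /p2 !(hornerD, hornerZ, hornerX, hornerXn, hornerC); ring.
have p10 : p1.[0] = c * X ^+ 2.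
  by rewrite /p1 !(hornerD, hornerZ, hornerX, hornerXn, hornerC); ring.
have p00 : p0.[0] = 0.
  by rewrite /p0 !(hornerD, hornerZ, hornerX, hornerXn, hornerC); ring.
apply: (@quadratic_specialization p2 p1 p0).
- by move=> z t z0; rewrite pE; apply: hG.
- by rewrite p20 mulf_neq0.
- by rewrite p10 p00 mulr0 subr0 !(mulf_neq0, expf_neq0).
- rewrite p20 p10 p00.
  have -> : c * X * y ^+ 2 + c * X ^+ 2 * y + 0 = c * X * (y * (X + y)) by ring.
  by rewrite hy mulr0.
Qed.

(* On u + v = 1 we approach (X : Y : 0; 1 - v, v) with u = 1 - v + s Z, the slope
   s being determined by the point. *)
Lemma cubic_line_limit (v X Y : algC) (G : algC -> {poly {poly algC}}) :
  X * Y * (X + Y) * (2%:R * X + Y) * (1 - v + v ^+ 2) != 0 ->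
  (forall s z x, z != 0 -> cubic_form (1 - v + s * z) v x Y z = 0 ->
     (G s).[x%:P].[z] = 0) ->
  exists s, (G s).[X%:P].[0] = 0.
Proof.
rewrite !mulf_eq0 !negb_or -!andbA => /and5P[X0 Y0 XY0 X2Y0 b0] hG.
set b := 1 - v + v ^+ 2 in b0.
(* Along u + v = 1 + s z the cubic is divisible by z. The quotient at z = 0 is s X Y (X + Y) + b
   (X^2 + X Y + Y^2), which this [s] annihilates. *)
pose s := - (b * (X ^+ 2 + X * Y + Y ^+ 2)) / (X * Y * (X + Y)).
exists s; move/(_ s) in hG.
pose q : {poly algC} := (1 - v)%:P + s *: 'X.
pose m : {poly algC} := q * v%:P.
pose sg : {poly algC} := q + v%:P.
pose p2 : {poly algC} := (s * Y)%:P + (sg - m).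
pose dd : {poly algC} := - sg ^+ 2 - m + 3%:R *: sg - 1%:P.
pose p1 : {poly algC} := (s * Y ^+ 2)%:P + dd * Y%:P - s%:P * (sg - m) * 'X^2.
pose p0 : {poly algC} :=
  (sg - m) * (Y ^+ 2)%:P + s%:P * m * 'X^3 - (s * Y)%:P * (sg - m) * 'X^2.
have qz z : q.[z] = 1 - v + s * z by rewrite /q !hornerE.
have mz z : m.[z] = q.[z] * v by rewrite /m hornerM hornerC.
have sgz z : sg.[z] = q.[z] + v by rewrite /sg hornerD hornerC.
have p2z z : p2.[z] = s * Y + (sg.[z] - m.[z]).
  by rewrite /p2 hornerD hornerC hornerD hornerN.
have ddz z : dd.[z] = - sg.[z] ^+ 2 - m.[z] + 3%:R * sg.[z] - 1.
  have h (A B : {poly algC}) : (- A ^+ 2 - B + 3%:R *: A - 1%:P).[z]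
      = - A.[z] ^+ 2 - B.[z] + 3%:R * A.[z] - 1.
    by rewrite !hornerD !hornerN horner_exp hornerZ hornerC.
  exact: h.
have p1z z : p1.[z] = s * Y ^+ 2 + dd.[z] * Y - s * (sg.[z] - m.[z]) * z ^+ 2.
  have h (A B : {poly algC}) : ((s * Y ^+ 2)%:P + A * Y%:P - s%:P * B * 'X^2).[z]
      = s * Y ^+ 2 + A.[z] * Y - s * B.[z] * z ^+ 2.
    by rewrite !hornerD hornerN !hornerM !hornerC !hornerX.
  by rewrite /p1 h hornerD hornerN.
have p0z z : p0.[z] = (sg.[z] - m.[z]) * Y ^+ 2 + s * m.[z] * z ^+ 3
    - s * Y * (sg.[z] - m.[z]) * z ^+ 2.
  have h (A B : {poly algC}) : (A * (Y ^+ 2)%:P + s%:P * B * 'X^3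
      - (s * Y)%:P * A * 'X^2).[z]
      = A.[z] * Y ^+ 2 + s * B.[z] * z ^+ 3 - s * Y * A.[z] * z ^+ 2.
    by rewrite !hornerD hornerN !hornerM !hornerC !hornerX.
  by rewrite /p0 h hornerD hornerN.
have pE z x : z * (p2.[z] * x ^+ 2 + p1.[z] * x + p0.[z])
    = cubic_form (1 - v + s * z) v x Y z.
  by rewrite p2z p1z p0z ddz sgz mz qz /cubic_form; ring.
have p20 : p2.[0] = - b * Y ^+ 2 / (X * (X + Y)).
  rewrite p2z sgz mz qz /s /b; field.
  by rewrite X0 XY0 Y0.
have p10 : p1.[0] = - b * Y ^+ 3 / (X * (X + Y)).
  rewrite p1z ddz sgz mz qz /s /b; field.
  by rewrite X0 XY0 Y0.
have p00 : p0.[0] = b * Y ^+ 2.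
  by rewrite p0z sgz mz qz /b; ring.
apply: (@quadratic_specialization p2 p1 p0).
- by move=> z x z0 h; apply: hG => //; rewrite -pE h mulr0.
- by rewrite p20 !(mulf_neq0, invr_neq0, expf_neq0, oppr_eq0).
(* At z = 0 the roots in x are X and - X - Y, which differ because 2 X + Y is nonzero. *)
- rewrite p20 p10 p00.
  have -> : (- b * Y ^+ 3 / (X * (X + Y))) ^+ 2
      - 4%:R * (- b * Y ^+ 2 / (X * (X + Y))) * (b * Y ^+ 2)
      = (b * Y ^+ 2 * (2%:R * X + Y) / (X * (X + Y))) ^+ 2.
    by field; rewrite X0 XY0.
  by rewrite !(mulf_neq0, invr_neq0, expf_neq0).
- by rewrite p20 p10 p00; field; rewrite X0 XY0.
Qed.

(** A point with Z = 0 and u + v != 1 satisfies X Y (X + Y) = 0 and is a limit within its own fibre.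
    Over u + v = 1 the whole line at infinity lies in the fibre; its general points are limits from
    neighbouring fibres, and the others follow by cancelling a nonzero polynomial. *)
Lemma threefold_finite_dense (g : {mpoly algC[3 + 2]}) :
  (forall X Y Z u v, Z != 0 -> cubic_form u v X Y Z = 0 ->
     g.@[fun i => [:: X; Y; Z; u; v]`_i] = 0) ->
  forall P, elliptic_threefold P -> g.@[coords P] = 0.
Proof.
move=> hg P; have [X [Y [Z [u [v ->]]]]] := pt5P P.
move=> /threefold_pt5[nz FP]; rewrite (meval_eq _ (coords_pt5 _ _ _ _ _)).
have [Z0|] := eqVneq Z 0; last by move=> Z0; apply: hg.
rewrite {}Z0 eqxx orbF in nz FP *.
have bivariate (a : seq {poly {poly algC}}) :
    exists G : {poly {poly algC}}, forall x z,
      G.[x%:P].[z] = g.@[fun i => [seq p.[x%:P].[z] | p <- a]`_i].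
  exists (mmap (@polyC _ \o @polyC algC) (fun i : 'I_(3 + 2) => a`_i) g) => x z.
  pose f := horner_eval z \o horner_eval x%:P : {rmorphism {poly {poly algC}} -> algC}.
  rewrite -[LHS]/(f _) rmorph_mmap_eval => [|t]; last first.
    by rewrite /f /= /horner_eval !hornerC.
  apply: meval_eq => i; have [lt|ge] := ltnP i (size a); first by rewrite (nth_map 0).
  by rewrite !nth_default ?size_map // rmorph0.
have FP' : (u + v - 1) * (X * Y * (X + Y)) = 0 by rewrite -FP /cubic_form; ring.
have [c0|c0] := eqVneq (u + v) 1; last first.
  have XY0 : X * Y * (X + Y) = 0.
    by move/eqP: FP'; rewrite mulf_eq0 subr_eq0 (negPf c0) => /eqP.
  have [X0|X0] := eqVneq X 0.
    have Y0 : Y != 0 by move: nz; rewrite X0 eqxx.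
    have [G hG] := bivariate [:: 'X; Y%:P%:P; 'X%:P; u%:P%:P; v%:P%:P].
    have e x z : G.[x%:P].[z] = g.@[fun i => [:: x; Y; z; u; v]`_i].
      by rewrite hG /= hornerX !hornerC hornerX.
    rewrite -e; apply: (cubic_infinity_limit c0 Y0) => [z y z0 h|].
      by rewrite e; apply: hg => //; rewrite cubic_formC.
    by rewrite X0 mul0r.
  have [G hG] := bivariate [:: X%:P%:P; 'X; 'X%:P; u%:P%:P; v%:P%:P].
  have e y z : G.[y%:P].[z] = g.@[fun i => [:: X; y; z; u; v]`_i].
    by rewrite hG /= hornerX !hornerC hornerX.
  rewrite -e; apply: (cubic_infinity_limit c0 X0) => [z y z0 h|].
    by rewrite e; apply: hg.
  by move/eqP: XY0; rewrite -mulrA mulf_eq0 (negPf X0) => /eqP.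
(* [p] is the restriction of [g] to the family (X : Y : 0; 1 - v, v), and [q] is the polynomial
   whose nonvanishing [cubic_line_limit] requires. *)
pose W (i : nat) : {mpoly algC[3]} := 'X_(inord i).
pose p := mmap (@mpolyC 3 algC)
  (fun i : 'I_(3 + 2) => [:: W 0; W 1; 0; 1 - W 2%N; W 2%N]`_i) g.
pose q := W 0 * W 1 * (W 0 + W 1) * (2%:R * W 0 + W 1) * (1 - W 2%N + W 2%N ^+ 2).
have pE w : p.@[w] = g.@[fun i => [:: w (inord 0); w (inord 1); 0;
    1 - w (inord 2); w (inord 2)]`_i].
  rewrite /p meval_mmapC; apply: meval_eq => i.
  rewrite -(nth_map _ 0 (meval w)) /= ?meval0 ?mevalB ?meval1 ?mevalXU //.
have qE w : q.@[w] = w (inord 0) * w (inord 1) * (w (inord 0) + w (inord 1))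
    * (2%:R * w (inord 0) + w (inord 1)) * (1 - w (inord 2) + w (inord 2) ^+ 2).
  have h (f : {rmorphism {mpoly algC[3]} -> algC}) A B C :
      f (A * B * (A + B) * (2%:R * A + B) * (1 - C + C ^+ 2))
      = f A * f B * (f A + f B) * (2%:R * f A + f B) * (1 - f C + f C ^+ 2).
    by rewrite !(rmorphM, rmorphD, rmorphN, rmorph1, rmorph_nat).
  by rewrite /q h /= !mevalXU.
have pq0 w : p.@[w] * q.@[w] = 0.
  rewrite qE; move: (pE w); set x := w (inord 0); set y := w (inord 1).
  set t := w (inord 2) => ->.
  have [->|nz'] := eqVneq (x * y * (x + y) * (2%:R * x + y) * (1 - t + t ^+ 2)) 0.
    by rewrite mulr0.
  pose a s : seq {poly {poly algC}} :=
    [:: 'X; y%:P%:P; 'X%:P; (1 - t)%:P%:P + (s *: 'X)%:P; t%:P%:P].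
  pose G s := mmap (@polyC _ \o @polyC algC) (fun i : 'I_(3 + 2) => (a s)`_i) g.
  have hG s x' z : (G s).[x'%:P].[z]
      = g.@[fun i => [:: x'; y; z; 1 - t + s * z; t]`_i].
    pose f := horner_eval z \o horner_eval x'%:P : {rmorphism {poly {poly algC}} -> algC}.
    rewrite -[LHS]/(f _) rmorph_mmap_eval => [|r]; last first.
      by rewrite /f /= /horner_eval !hornerC.
    apply: meval_eq => i; rewrite -(nth_map _ 0 f); last exact: (ltn_ord i).
    by rewrite /f /= /horner_eval hornerX hornerD !hornerC hornerD hornerZ !hornerX hornerC.
  have [s] := cubic_line_limit nz' (G := G) (fun s z x' z0 h =>
    etrans (hG s x' z) (hg _ _ _ _ _ z0 h)).
  by rewrite hG mulr0 addr0 => ->; rewrite mul0r.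
have p0 : forall w, p.@[w] = 0.
  (* At X = Y = 1, v = 0 the polynomial [q] equals 6. *)
  apply: (meval_cancel (v1 := fun i => [:: 1; 1; 0]`_i) pq0).
  rewrite qE !inordK //= subr0 expr0n addr0 !mulr1 mul1r.
  have -> : (1 + 1) * (2%:R + 1) = 6%:R :> algC by ring.
  by rewrite pnatr_eq0.
have -> : u = 1 - v by rewrite -c0 addrK.
by have := p0 (fun i => [:: X; Y; v]`_i); rewrite pE !inordK.
Qed.

(** * The birational map *)

Section XDegree.
Variables n m : nat.

(** As a measure on monomials, this turns [xhomog] into homogeneity for [xdeg], which brings the
    closure properties of homogeneous polynomials. *)
Definition xdeg (mon : 'X_{1..n.+1 + m}) := (\sum_(i < n.+1) mon (lshift m i))%N.

Fact xdeg0 : xdeg 0%MM = 0%N.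
Proof. by rewrite /xdeg big1 // => i _; rewrite mnm0E. Qed.

Fact xdegD : {morph xdeg : m1 m2 / (m1 + m2)%MM >-> (m1 + m2)%N}.
Proof.
by move=> m1 m2; rewrite /xdeg -big_split; apply: eq_bigr => i _; rewrite mnmDE.
Qed.

HB.instance Definition _ := isMeasure.Build (n.+1 + m) xdeg xdeg0 xdegD.

Variable R : comNzRingType.
Implicit Types p q : {mpoly R[n.+1 + m]}.

Lemma xhomogE d p : xhomog d p = (p \is d.-homog for xdeg).
Proof. by []. Qed.

Lemma xhomogD d p q : xhomog d p -> xhomog d q -> xhomog d (p + q).
Proof. by rewrite !xhomogE; apply: dhomogD. Qed.

Lemma xhomogN d p : xhomog d p -> xhomog d (- p).
Proof. by rewrite !xhomogE => h; rewrite rpredN. Qed.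

Lemma xhomogM d e p q : xhomog d p -> xhomog e q -> xhomog (d + e) (p * q).
Proof. by rewrite !xhomogE; apply: dhomogM. Qed.

Lemma xhomog1 : xhomog 0 (1 : {mpoly R[n.+1 + m]}).
Proof. by rewrite xhomogE; apply: dhomog1. Qed.

Lemma xhomog_proj i : xhomog 1 ('X_(lshift m i) : {mpoly R[n.+1 + m]}).
Proof.
rewrite xhomogE dhomogX /= /xdeg (bigD1 i) //= mnm1E eqxx big1 ?addn0 // => j ji.
by rewrite mnm1E (inj_eq (@lshift_inj _ _)) eq_sym (negPf ji).
Qed.

Lemma xhomog_affine j : xhomog 0 ('X_(rshift n.+1 j) : {mpoly R[n.+1 + m]}).
Proof.
rewrite xhomogE dhomogX /= /xdeg big1 // => i _.
by rewrite mnm1E eq_sym eq_lrshift.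
Qed.

End XDegree.

Definition Bvar (k : nat) : {mpoly rat[6 + 0]} := 'X_(lshift 0 (inord k : 'I_6)).

Definition psi : ratmap 5 0 2 2 := {|
  rm_proj := fun i : 'I_3 => [:: Bvar 0; Bvar 1; Bvar 4]`_i;
  rm_num := fun j : 'I_2 => [:: - Bvar 2; - Bvar 3]`_j;
  rm_den := Bvar 4
|}.

Lemma phi_homog : rm_homog phi.
Proof.
split; last by exists 0%N; split=> [|[]//]; apply: xhomog1.
exists 1%N => i.
have hX : xhomog 1 PX by exact: xhomog_proj.
have hY : xhomog 1 PY by exact: xhomog_proj.
have hZ : xhomog 1 PZ by exact: xhomog_proj.
have hu : xhomog 0 Pu by exact: xhomog_affine.
have hv : xhomog 0 Pv by exact: xhomog_affine.
have h1 : xhomog 0 (- 1 : {mpoly rat[3 + 2]}) by exact/xhomogN/xhomog1.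
have huZ := xhomogN (xhomogM hu hZ); have hvZ := xhomogN (xhomogM hv hZ).
have hl := xhomogM (xhomogD (xhomogD hu hv) h1) hZ.
have h5 := xhomogD (xhomogD (xhomogN hX) (xhomogN hY)) hl.
by case: i => [[|[|[|[|[|[|]]]]]]].
Qed.

Lemma psi_homog : rm_homog psi.
Proof.
have h k : xhomog 1 (Bvar k) by exact: xhomog_proj.
split; first by exists 1%N; case=> [[|[|[|]]]] //= _; apply: h.
exists 1%N; split; first exact: h.
by case=> [[|[|]]] //= _; apply: xhomogN.
Qed.

Lemma evalQ_Bvar P k : evalQ (Bvar k) P = xc P k.
Proof.
have [f [fE fX]] := evalQ_rmorph P.
by rewrite -fE fX /coords row_mxEl.
Qed.

Definition phi_coords (X Y Z u v : algC) :=
  [:: X; Y; - (u * Z); - (v * Z); Z; - X - Y + (u + v - 1) * Z].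

Lemma rm_app_phi X Y Z u v :
  rm_app phi (pt5 X Y Z u v) = seqpt (phi_coords X Y Z u v).
Proof.
congr pair; last by apply/rowP => -[].
have [[hX hY hZ] [hu hv]] := pt5_var X Y Z u v.
have [f [fE _]] := evalQ_rmorph (pt5 X Y Z u v).
apply/rowP => i; rewrite !mxE /phi_coords.
have -> : [:: X; Y; - (u * Z); - (v * Z); Z; - X - Y + (u + v - 1) * Z] =
    map f [:: PX; PY; - (Pu * PZ); - (Pv * PZ); PZ; - PX - PY + (Pu + Pv - 1) * PZ].
  rewrite /= !(rmorphD, rmorphB, rmorphN, rmorphM, rmorph1) /=.
  by rewrite !fE hX hY hZ hu hv.
by rewrite (nth_map 0) ?fE; [|exact: (ltn_ord i)].
Qed.

Lemma rm_dom_phi P : P.1 != 0 -> rm_dom phi P.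
Proof.
have [X [Y [Z [u [v ->]]]]] := pt5P P => /pt5_neq0 nz.
have [[hX hY hZ] _] := pt5_var X Y Z u v.
split; last first.
  by have [f [fE _]] := evalQ_rmorph (pt5 X Y Z u v); rewrite -fE rmorph1 oner_neq0.
case/or3P: nz => h; [exists (inord 0) | exists (inord 1) | exists (inord 4)];
  by rewrite /= inordK //= (hX, hY, hZ).
Qed.

Lemma rm_app_psi P : rm_app psi P =
  pt5 (xc P 0) (xc P 1) (xc P 4) (- xc P 2 / xc P 4) (- xc P 3 / xc P 4).
Proof.
have [f [fE _]] := evalQ_rmorph P.
have fB k : f (Bvar k) = xc P k by rewrite fE evalQ_Bvar.
congr pair; apply/rowP => i; rewrite !mxE -?fE.
  by case: i => [[|[|[|]]]] //= _; rewrite fB.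
by case: i => [[|[|]]] //= _; rewrite fB rmorphN fB.
Qed.

Lemma rm_dom_psi P : rm_dom psi P <-> xc P 4 != 0.
Proof.
split=> [[_]|h]; first by rewrite evalQ_Bvar.
by split; rewrite ?evalQ_Bvar //; exists (inord 2); rewrite /= inordK //= evalQ_Bvar.
Qed.

(** Pulled back along [phi], sigma_1 is zero and sigma_4 is Z times the cubic. *)
Lemma phi_Bprime X Y Z u v : elliptic_threefold (pt5 X Y Z u v) ->
  Bprime (seqpt (phi_coords X Y Z u v)).
Proof.
move=> /threefold_pt5[nz F0]; apply/BprimeE; rewrite !xc_seqpt //=; split.
- apply/eqP => /rowP e; move: nz.
  have := e (inord 0); have := e (inord 1); have := e (inord 4).
  by rewrite !mxE !inordK //= => -> -> ->; rewrite eqxx.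
- by rewrite /esym1; ring.
- apply: etrans (_ : Z * cubic_form u v X Y Z = 0); last by rewrite F0 mulr0.
  by rewrite /esym2 /esym3 /esym4 /cubic_form; ring.
Qed.

Lemma psi_threefold P : Bprime P -> xc P 4 != 0 ->
  elliptic_threefold (rm_app psi P).
Proof.
move=> /BprimeE[_ s1 s4] z0; rewrite rm_app_psi; apply/threefold_pt5.
split; first by rewrite z0 !orbT.
move: s1 s4 z0; move: (xc P 0) (xc P 1) (xc P 2) (xc P 3) (xc P 4) (xc P 5).
move=> x0 x1 x2 x3 x4 x5 s1 s4 z0; apply: (mulfI z0); rewrite mulr0 -s4.
have -> : x5 = - (x0 + x1 + x2 + x3 + x4).
  by apply/eqP; rewrite -addr_eq0 -s1; apply/eqP; rewrite /esym1; ring.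
by rewrite /esym2 /esym3 /esym4 /cubic_form; field.
Qed.

Lemma same_point_refl n m (P Q : ppoint n m) : Q = P -> same_point P Q.
Proof.
by move=> ->; split=> //; exists 1; rewrite ?oner_neq0 // scale1r.
Qed.

Lemma psi_phi P : elliptic_threefold P -> rm_dom psi (rm_app phi P) ->
  rm_app psi (rm_app phi P) = P.
Proof.
have [X [Y [Z [u [v ->]]]]] := pt5P P => _.
rewrite rm_app_phi rm_dom_psi rm_app_psi !xc_seqpt //= => Z0.
by rewrite !opprK !mulfK.
Qed.

Lemma phi_psi P : Bprime P -> rm_dom psi P -> rm_app phi (rm_app psi P) = P.
Proof.
move=> /BprimeE[_ s1 _] /rm_dom_psi z0; rewrite rm_app_psi rm_app_phi.
have x5 : xc P 5 = - xc P 0 - xc P 1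
    + (- xc P 2 / xc P 4 + - xc P 3 / xc P 4 - 1) * xc P 4.
  apply/eqP; rewrite -subr_eq0 -s1; apply/eqP; rewrite /esym1; field.
  exact: z0.
case: P s1 z0 x5 => x y s1 z0 x5; congr pair; last by apply/rowP => -[].
have xE i k : nat_of_ord i = k -> x 0 i = xc (x, y) k by move=> <-; rewrite /xc inord_val.
apply/rowP => i; rewrite mxE (xE i i) // /phi_coords -x5.
by case: i => [[|[|[|[|[|[|]]]]]]] //= _; rewrite divfK ?opprK.
Qed.

(** [phi] is defined on the whole threefold and [psi] exactly where x5 is nonzero, so the density
    conditions reduce to the loci Z != 0 and x5 != 0. *)
Lemma phi_birational : birational_map elliptic_threefold Bprime phi.
Proof.
have dom P : elliptic_threefold P -> rm_dom phi P by case=> P0 _; apply: rm_dom_phi.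
have dense_E (S : ppoint 2 2 -> Prop) : (forall P, S P -> elliptic_threefold P) ->
    (forall X Y Z u v, Z != 0 -> elliptic_threefold (pt5 X Y Z u v) ->
       S (pt5 X Y Z u v)) -> zariski_dense S elliptic_threefold.
  move=> SE hS; split=> // d g _ g0; apply: threefold_finite_dense.
  move=> X Y Z u v Z0 F0; rewrite -(meval_eq _ (coords_pt5 X Y Z u v)).
  by apply/g0/hS => //; apply/threefold_pt5; rewrite Z0 !orbT.
have dense_B (S : ppoint 5 0 -> Prop) : (forall P, S P -> Bprime P) ->
    (forall P, Bprime P -> xc P 4 != 0 -> S P) -> zariski_dense S Bprime.
  move=> SB hS; split=> // d g hg g0; apply: (torus_dense hg) => Q [[hQ _] nz].
  by apply: g0; apply: hS => //; apply: nz.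
split; first split.
- exact: phi_homog.
- by apply: dense_E => [P []|*] //; split=> //; apply: dom.
- move=> P; have [X [Y [Z [u [v ->]]]]] := pt5P P => hP _.
  by rewrite rm_app_phi; apply: phi_Bprime.
exists psi; split; first split.
- exact: psi_homog.
- by apply: dense_B => [P []|P hP z0] //; split=> //; apply/rm_dom_psi.
- by move=> P hP /rm_dom_psi; apply: psi_threefold.
- split; last by move=> P hP _ h; apply/same_point_refl/psi_phi.
  apply: dense_E => [P [] //|X Y Z u v Z0 hP]; split=> //; first exact: dom.
  by rewrite rm_app_phi; apply/rm_dom_psi; rewrite xc_seqpt.
- split; last by move=> P hP h _; apply/same_point_refl/phi_psi.
  apply: dense_B => [P [] //|P hP z0]; split=> //; first exact/rm_dom_psi.
  by apply/dom/psi_threefold.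
Qed.

(** * Flexes *)

Section Cubic.
Variable R : comNzRingType.
Implicit Types u v X Y Z : R.

Definition coef_c u v := u + v - 1.
Definition coef_b u v := - (u * v) + u + v.
Definition coef_d u v :=
  - u ^+ 2 - 3%:R * u * v + 3%:R * u - v ^+ 2 + 3%:R * v - 1.
Definition coef_e u v := u ^+ 2 * v + u * v ^+ 2 - u * v.
Definition coef_f u v :=
  u ^+ 2 * v - u ^+ 2 + u * v ^+ 2 - 3%:R * u * v + u - v ^+ 2 + v.

(** Partial derivatives. By the symmetry of the cubic in X and Y, the derivative in Y is
    [cubic_dX u v Y X Z]. *)
Definition cubic_dX u v X Y Z :=
  coef_c u v * (2%:R * X * Y + Y ^+ 2) + coef_b u v * (2%:R * X * Z)
  + coef_d u v * (Y * Z) + coef_f u v * Z ^+ 2.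
Definition cubic_dZ u v X Y Z :=
  coef_b u v * (X ^+ 2 + Y ^+ 2) + coef_d u v * (X * Y)
  + coef_e u v * (3%:R * Z ^+ 2) + coef_f u v * ((X + Y) * (2%:R * Z)).

(** Exchanging the two points reverses the expansion of a cubic form, so the t^2 coefficient is the
    gradient at the direction applied to the base point. *)
Lemma cubic_form_taylor u v X Y Z A B C t :
  cubic_form u v (X + A * t) (Y + B * t) (Z + C * t) =
  cubic_form u v X Y Z
  + (cubic_dX u v X Y Z * A + cubic_dX u v Y X Z * B + cubic_dZ u v X Y Z * C) * t
  + (cubic_dX u v A B C * X + cubic_dX u v B A C * Y + cubic_dZ u v A B C * Z)
    * t ^+ 2
  + cubic_form u v A B C * t ^+ 3.
Proof.
by rewrite /cubic_form /cubic_dX /cubic_dZ /coef_b /coef_c /coef_d /coef_e /coef_f; ring.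
Qed.

End Cubic.

Lemma mderivXU (R : comNzRingType) n (i j : 'I_n) :
  ('X_j : {mpoly R[n]})^`M(i) = (i == j)%:R.
Proof.
rewrite mderivX mnm1E eq_sym; case: eqVneq => [->|_]; last by rewrite scale0r.
rewrite scale1r (_ : (_ - _)%MM = 0%MM) ?mpolyX0 //.
by apply/mnmP => k; rewrite mnmBE subnn mnm0E.
Qed.

Lemma cubic_formE (R S : comNzRingType) (f : {rmorphism R -> S}) u v X Y Z :
  cubic_form (f u) (f v) X Y Z =
  f (coef_c u v) * (X * Y * (X + Y)) + f (coef_b u v) * ((X ^+ 2 + Y ^+ 2) * Z)
  + f (coef_d u v) * (X * Y * Z) + f (coef_e u v) * Z ^+ 3
  + f (coef_f u v) * ((X + Y) * Z ^+ 2).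
Proof.
rewrite /coef_b /coef_c /coef_d /coef_e /coef_f.
by rewrite !(rmorphD, rmorphN, rmorphM, rmorph1, rmorph_nat).
Qed.

Lemma rmorph_cubic_dX (R S : comNzRingType) (f : {rmorphism R -> S}) u v X Y Z :
  f (cubic_dX u v X Y Z) = cubic_dX (f u) (f v) (f X) (f Y) (f Z).
Proof.
rewrite /cubic_dX /coef_b /coef_c /coef_d /coef_f.
by rewrite !(rmorphD, rmorphN, rmorphM, rmorph1, rmorph_nat).
Qed.

Lemma rmorph_cubic_dZ (R S : comNzRingType) (f : {rmorphism R -> S}) u v X Y Z :
  f (cubic_dZ u v X Y Z) = cubic_dZ (f u) (f v) (f X) (f Y) (f Z).
Proof.
rewrite /cubic_dZ /coef_b /coef_d /coef_e /coef_f.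
by rewrite !(rmorphD, rmorphN, rmorphM, rmorph1, rmorph_nat).
Qed.

Section PlaneCubic.
Variables u v : algC.
Let F := curveC u v.

Lemma rmorph_curveC (S : comNzRingType) (f : {rmorphism {mpoly algC[3]} -> S}) :
  f F = cubic_form (f u%:MP) (f v%:MP) (f 'X_(inord 0)) (f 'X_(inord 1)) (f 'X_(inord 2)).
Proof. exact: rmorph_cubic_form. Qed.

Lemma meval_curveC (w : 'I_3 -> algC) :
  F.@[w] = cubic_form u v (w (inord 0)) (w (inord 1)) (w (inord 2)).
Proof. by rewrite rmorph_curveC /= !mevalC !mevalXU. Qed.

Lemma mderiv_curveC (w : 'I_3 -> algC) :
  let: (X, Y, Z) := (w (inord 0), w (inord 1), w (inord 2)) in
  [/\ F^`M(inord 0).@[w] = cubic_dX u v X Y Z,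
      F^`M(inord 1).@[w] = cubic_dX u v Y X Z
    & F^`M(inord 2).@[w] = cubic_dZ u v X Y Z].
Proof.
have E i : F^`M(i).@[w] =
  let D j := (i == inord j)%:R in
  let: (X, Y, Z) := (w (inord 0), w (inord 1), w (inord 2)) in
  cubic_dX u v X Y Z * D 0 + cubic_dX u v Y X Z * D 1 + cubic_dZ u v X Y Z * D 2%N.
  rewrite /F /curveC (cubic_formE (@mpolyC 3 algC)) /= !expr2 !exprS expr0 mulr1.
  rewrite !(mderivD, mderivM, mderivC, mderivXU) !(mevalD, mevalM, mevalC, mevalXU).
  by rewrite /cubic_dX /cubic_dZ; ring.
have eqE a b : (a < 3)%N -> (b < 3)%N ->
    (inord a == inord b :> 'I_3) = (a == b).
  by move=> a3 b3; rewrite -val_eqE /= !inordK.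
by split; rewrite E /= !eqE //=; ring.
Qed.

Lemma sum_ord3 (R : nmodType) (h : 'I_3 -> R) :
  \sum_i h i = h (inord 0) + h (inord 1) + h (inord 2).
Proof.
do 3![rewrite big_ord_recr /=]; rewrite big_ord0 add0r.
by do ![congr (_ + _)]; congr h; apply/val_inj; rewrite /= inordK.
Qed.

Lemma vec3E a b c :
  [/\ vec3 a b c 0 (inord 0) = a, vec3 a b c 0 (inord 1) = b
    & vec3 a b c 0 (inord 2) = c].
Proof. by rewrite /vec3; split; rewrite mxE inordK. Qed.

(* The quadratic term of the restriction to a line is the polar form
   \sum_i (dF/dx_i)(Q) P_i. *)
Lemma flex_criterion a b c : vec3 a b c != 0 ->
  cubic_form u v a b c = 0 ->
  [|| cubic_dX u v a b c != 0, cubic_dX u v b a c != 0 | cubic_dZ u v a b c != 0] ->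
  (forall x y z,
     cubic_dX u v a b c * x + cubic_dX u v b a c * y + cubic_dZ u v a b c * z = 0 ->
     cubic_dX u v x y z * a + cubic_dX u v y x z * b + cubic_dZ u v x y z * c = 0) ->
  flex_point F (vec3 a b c).
Proof.
move=> nz F0 sm polar; have [ea eb ec] := vec3E a b c.
have [d0 d1 d2] := mderiv_curveC (vec3 a b c 0); rewrite ea eb ec in d0 d1 d2.
split.
- by split=> //; rewrite meval_curveC ea eb ec.
- by case/or3P: sm => h; [exists (inord 0) | exists (inord 1) | exists (inord 2)];
    rewrite (d0, d1, d2).
- move=> Q; rewrite sum_ord3 d0 d1 d2 => hQ; have hp := polar _ _ _ hQ.
  rewrite /restrict_line rmorph_curveC /= !mmapC !mmapX !mmap1U ea eb ec.
  rewrite -!mul_polyC cubic_form_taylor.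
  rewrite -!(rmorph_cubic_form (@polyC algC)) -!(rmorph_cubic_dX (@polyC algC)).
  rewrite -!(rmorph_cubic_dZ (@polyC algC)) /= -!polyCM -!polyCD hQ hp F0.
  by rewrite !mul0r !add0r dvdp_mull.
Qed.

(** The cubic thus depends on c, b and e alone, with d = b - c^2 and f = - c b. *)
Lemma coef_relations : coef_d u v - coef_b u v = - coef_c u v ^+ 2 /\
  coef_f u v = - coef_c u v * coef_b u v.
Proof. by rewrite /coef_b /coef_c /coef_d /coef_f; split; ring. Qed.

Hypothesis uv : u + v != 1.

Let c_neq0 : coef_c u v != 0.
Proof. by rewrite subr_eq0. Qed.

(** The tangent line is c y + b z = 0, and the polar form vanishes on it by [coef_relations]. *)
Lemma flex100 : flex_point F (vec3 1 0 0).
Proof.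
have [rd rf] := coef_relations; move/eqP: rd; rewrite subr_eq => /eqP rd.
apply: flex_criterion.
- by apply/eqP => /rowP/(_ (inord 0)); rewrite !mxE inordK //= => /eqP; rewrite oner_eq0.
- by rewrite /cubic_form; ring.
- apply/or3P; constructor 2; rewrite /cubic_dX.
  by rewrite (_ : _ + _ = coef_c u v) //; ring.
move=> x y z; rewrite /cubic_dX /cubic_dZ rd rf => h.
have -> : y = - coef_b u v * z / coef_c u v.
  apply: (mulfI c_neq0); rewrite mulrCA divff // mulr1; apply/eqP.
  by rewrite -subr_eq0 -h; apply/eqP; ring.
by field.
Qed.

Lemma flex010 : flex_point F (vec3 0 1 0).
Proof.
have [rd rf] := coef_relations; move/eqP: rd; rewrite subr_eq => /eqP rd.
apply: flex_criterion.
- by apply/eqP => /rowP/(_ (inord 1)); rewrite !mxE inordK //= => /eqP; rewrite oner_eq0.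
- by rewrite /cubic_form; ring.
- apply/or3P; constructor 1; rewrite /cubic_dX.
  by rewrite (_ : _ + _ = coef_c u v) //; ring.
move=> x y z; rewrite /cubic_dX /cubic_dZ rd rf => h.
have -> : x = - coef_b u v * z / coef_c u v.
  apply: (mulfI c_neq0); rewrite mulrCA divff // mulr1; apply/eqP.
  by rewrite -subr_eq0 -h; apply/eqP; ring.
by field.
Qed.

(** The tangent line is c (x + y) = (b + c^2) z. *)
Lemma flex1N10 : flex_point F (vec3 1 (- 1) 0).
Proof.
have [rd rf] := coef_relations; move/eqP: rd; rewrite subr_eq => /eqP rd.
apply: flex_criterion.
- by apply/eqP => /rowP/(_ (inord 0)); rewrite !mxE inordK //= => /eqP; rewrite oner_eq0.
- by rewrite /cubic_form; ring.
- apply/or3P; constructor 1; rewrite /cubic_dX.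
  by rewrite (_ : _ + _ = - coef_c u v) ?oppr_eq0 //; ring.
move=> x y z; rewrite /cubic_dX /cubic_dZ rd rf => h.
have -> : y = (coef_b u v + coef_c u v ^+ 2) * z / coef_c u v - x.
  apply: (mulfI c_neq0); rewrite mulrBr mulrCA divff // mulr1; apply/eqP.
  by rewrite -subr_eq0 -oppr_eq0 -h; apply/eqP; ring.
by field.
Qed.

End PlaneCubic.

(** * Genus *)

Section HomogeneousFactors.
Variables (R : idomainType) (n : nat).
Implicit Types p q : {mpoly R[n]}.

(** In any other pair of monomials with the same product, one lies below the last monomial of its
    factor and has coefficient 0. *)
Lemma mcoeff_mlastM p q :
  (p * q)@_(mlast p + mlast q) = p@_(mlast p) * q@_(mlast q).
Proof.
rewrite mcoeffM.
pose D := (mdeg (mlast p + mlast q)%MM).+1.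
have lp : (mdeg (mlast p) < D)%N by rewrite /D mdegD ltnS leq_addr.
have lq : (mdeg (mlast q) < D)%N by rewrite /D mdegD ltnS leq_addl.
rewrite (bigD1 (BMultinom lp, BMultinom lq)) //= big1 ?addr0 // => -[[k1 h1] [k2 h2]] /=.
case/andP=> /eqP e ne.
have [/mcoeff_lt_mlast ->|le1] := ltP k1 (mlast p); first by rewrite mul0r.
have [/mcoeff_lt_mlast ->|le2] := ltP k2 (mlast q); first by rewrite mulr0.
move: le1; rewrite le_eqVlt => /orP[/eqP e1|lt1]; last first.
  by have := ltmc_le_add lt1 le2; rewrite e ltxx.
move: e; rewrite e1 => /addmI e2; case/eqP: ne.
by congr pair; apply/val_inj.
Qed.

(** The leading and last monomials of the product are the products of those of the factors. Both
    have degree d, so the lowest and highest degrees agree in each factor. *)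
Lemma dhomog_factor d p q : p * q != 0 -> p * q \is d.-homog ->
  exists i j, [/\ (i + j)%N = d, p \is i.-homog & q \is j.-homog].
Proof.
move=> nz /dhomogP hom.
have [p0 q0] : p != 0 /\ q != 0 by apply/andP; rewrite -negb_or -mulf_eq0.
have top : (mdeg (mlead p) + mdeg (mlead q))%N = d.
  by rewrite -mdegD -mleadM //; apply/hom/mlead_supp.
have bot : (mdeg (mlast p) + mdeg (mlast q))%N = d.
  rewrite -mdegD; apply: hom; rewrite mcoeff_msupp mcoeff_mlastM mulf_neq0 //;
  by rewrite -mcoeff_msupp mlast_supp.
have between (r : {mpoly R[n]}) m : m \in msupp r ->
    (mdeg (mlast r) <= mdeg m <= mdeg (mlead r))%N.
  by move=> hm; rewrite !lemc_mdeg ?mlast_lemc ?msupp_le_mlead.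
have /andP[_ lep] := between _ _ (mlast_supp p0).
have /andP[_ leq] := between _ _ (mlast_supp q0).
exists (mdeg (mlead p)), (mdeg (mlead q)).
by split=> //; apply/dhomogP => m /between/andP[h1 h2] /=; move: top bot lep leq h1 h2; lia.
Qed.

Lemma dhomog_scale d p t v : p \is d.-homog ->
  p.@[fun i => t * v i] = t ^+ d * p.@[v].
Proof.
move=> /dhomogP hp; rewrite !mevalE mulr_sumr; apply: eq_big_seq => m /hp <-.
rewrite mulrCA /= mdegE -prodrXr; congr (_ * _); rewrite -big_split.
by apply: eq_bigr => i _; rewrite exprMn.
Qed.

Lemma dhomog1_meval p v : p \is 1.-homog -> p.@[v] = \sum_i p@_(U_(i)) * v i.
Proof.
move=> hp; have {1}-> : p = \sum_i p@_(U_(i)) *: 'X_i.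
  apply/mpolyP => m; rewrite raddf_sum /=.
  under eq_bigr do rewrite mcoeffZ mcoeffX.
  have [/mdeg1P[j /eqP ->]|m1] := boolP (mdeg m == 1%N).
    rewrite (bigD1 j) //= eqxx mulr1 big1 ?addr0 // => i ij.
    by rewrite eq_mnm1 (negPf ij) mulr0.
  rewrite (dhomog_nemf_coeff hp m1) big1 // => i _.
  by rewrite (_ : (_ == m) = false) ?mulr0 //; apply: contraNF m1 => /eqP <-; rewrite mdeg1.
by rewrite raddf_sum; apply: eq_bigr => i _; rewrite /= mevalZ mevalXU.
Qed.

End HomogeneousFactors.

Lemma vec3P (P : 'rV[algC]_3) :
  P = vec3 (P 0 (inord 0)) (P 0 (inord 1)) (P 0 (inord 2)).
Proof.
apply/rowP => i; rewrite mxE.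
by case: i => [[|[|[|]]]] //= p; congr (P 0 _); apply/val_inj; rewrite /= inordK.
Qed.

Lemma vec3_eq0 a b c : (vec3 a b c == 0) = [&& a == 0, b == 0 & c == 0].
Proof.
apply/eqP/and3P => [/rowP e|[/eqP-> /eqP-> /eqP->]]; last first.
  by apply/rowP => i; rewrite !mxE; case: i => [[|[|[|]]]].
have := e (inord 0); have := e (inord 1); have := e (inord 2).
by rewrite !mxE !inordK //= => -> -> ->.
Qed.

Section CommonZero.
Variables G H : {mpoly algC[3]}.

(** On the line p + t q the form [H] becomes a univariate polynomial, which has a root unless it is
    a nonzero constant. In that case homogeneity puts the common zero at the point q at infinity. *)
Lemma line_meets_curve d : (0 < d)%N -> G \is 1.-homog -> H \is d.-homog ->
  exists w : 'rV[algC]_3, [/\ w != 0, G.@[w 0] = 0 & H.@[w 0] = 0].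
Proof.
move=> d0 hG hH.
have GE w : G.@[w] = G@_(U_(inord 0)) * w (inord 0) + G@_(U_(inord 1)) * w (inord 1)
    + G@_(U_(inord 2)) * w (inord 2).
  by rewrite dhomog1_meval // sum_ord3.
move: (G@_ _) (G@_ _) (G@_ _) GE => c b a GE.
have [p [q [pq0 q0 lin]]] : exists p q : 'rV[algC]_3,
    [/\ forall t, p + t *: q != 0, q != 0 & forall x y, G.@[(x *: p + y *: q) 0] = 0].
  have mk x y z x' y' z' : 
      (forall t, ~~ [&& x + t * x' == 0, y + t * y' == 0 & z + t * z' == 0]) ->
      ~~ [&& x' == 0, y' == 0 & z' == 0] ->
      a * x + b * y + c * z = 0 -> a * x' + b * y' + c * z' = 0 ->
      exists p q : 'rV[algC]_3, [/\ forall t, p + t *: q != 0, q != 0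
        & forall x y, G.@[(x *: p + y *: q) 0] = 0].
    move=> h1 h2 e1 e2; exists (vec3 x y z), (vec3 x' y' z').
    have add s t : s *: vec3 x y z + t *: vec3 x' y' z'
        = vec3 (s * x + t * x') (s * y + t * y') (s * z + t * z').
      by apply/rowP => i; rewrite !mxE; case: i => [[|[|[|]]]].
    split; first by move=> t; rewrite -[vec3 x y z]scale1r add vec3_eq0 !mul1r h1.
      by rewrite vec3_eq0.
    move=> s t; rewrite add GE; have [-> -> ->] := vec3E (s * x + t * x')
      (s * y + t * y') (s * z + t * z').
    transitivity (s * (a * x + b * y + c * z) + t * (a * x' + b * y' + c * z')).
      by ring.
    by rewrite e1 e2 !mulr0 addr0.
  (* Two independent points of a x + b y + c z = 0 are chosen according to which coefficient is
     nonzero. *)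
  have [c0|c0] := eqVneq c 0; last first.
    apply: (mk c 0 (- a) 0 c (- b)); rewrite ?(negPf c0) ?andbF //=; try by ring.
    by move=> t; rewrite mulr0 addr0 (negPf c0).
  have [b0|b0] := eqVneq b 0; last first.
    apply: (mk b (- a) 0 0 0 1); rewrite ?oner_eq0 ?andbF //; try by (rewrite ?c0; ring).
    by move=> t; rewrite mulr0 addr0 (negPf b0).
  apply: (mk 0 1 0 0 0 1); rewrite ?oner_eq0 ?andbF //; try by (rewrite ?c0 ?b0; ring).
  by move=> t; rewrite mulr0 !addr0 oner_eq0 andbF.
have [Hq|Hq] := eqVneq H.@[q 0] 0.
  by exists q; split=> //; rewrite -[q]scale1r -[_ *: q]add0r -(scale0r p) lin.
pose h := mmap (@polyC algC) (fun i => (p 0 i)%:P + q 0 i *: 'X) H.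
have hE t : h.[t] = H.@[(p + t *: q) 0].
  by rewrite -meval_horner; apply: meval_eq => i; rewrite !mxE !hornerE mulrC.
have [sz1|/closed_rootP[t /eqP ht]] := boolP (size h == 1); last first.
  exists (p + t *: q); rewrite pq0 -hE ht.
  by split=> //; rewrite -[X in X + _]scale1r lin.
case/eqP: Hq; have /size_poly1P[k k0 hk] := sz1.
pose h' := mmap (@polyC algC) (fun i => (q 0 i)%:P + p 0 i *: 'X) H.
have h'E t : h'.[t] = H.@[(q + t *: p) 0].
  by rewrite -meval_horner; apply: meval_eq => i; rewrite !mxE !hornerE mulrC.
(* By homogeneity H (q + t p) = t^d h (1 / t), and h is the constant k. *)
have h'X : h' = k *: 'X^d.
  apply/eqP; rewrite -subr_eq0; apply/eqP.
  apply: (@poly_eq0_infinite _ _ (fun n => n.+1%:R)) => [i j /eqP|n].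
    by rewrite eqr_nat => /eqP[].
  set t := n.+1%:R; have t0 : t != 0 :> algC by rewrite pnatr_eq0.
  rewrite hornerD hornerN hornerZ hornerXn h'E.
  have := hE t^-1; rewrite hk hornerC => {1}->.
  rewrite [_ * t ^+ d]mulrC -(dhomog_scale _ _ hH); apply/eqP; rewrite subr_eq0.
  by apply/eqP/meval_eq => i; rewrite !mxE mulrDr mulVKf // addrC.
have := h'E 0; rewrite scale0r addr0 => <-.
by rewrite h'X hornerZ hornerXn expr0n eqn0Ngt d0 mulr0.
Qed.

End CommonZero.

Lemma dhomog_msizeE (R : comNzRingType) n d (p : {mpoly R[n]}) :
  p != 0 -> p \is d.-homog -> msize p = d.+1.
Proof.
by move=> p0 /dhomogP hp; rewrite -mlead_deg // (hp _ (mlead_supp p0)).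
Qed.

(** * Irreducibility and Hilbert function of plane cubics *)

Section CubicCurve.
Variable F : {mpoly algC[3]}.
Hypotheses (F0 : F != 0) (F3 : F \is 3.-homog).

(** Nonconstant factors of a cubic have degrees 1 and 2, so one is a line and meets the other; by
    the product rule the gradient vanishes at a common zero. *)
Lemma nonsingular_irreducible : nonsingular_curve F -> irreducible_curve F.
Proof.
move=> ns; split=> [|G H FE]; first by rewrite (dhomog_msizeE F0 F3).
have common (w : 'rV[algC]_3) : w != 0 -> G.@[w 0] = 0 -> H.@[w 0] = 0 -> False.
  move=> w0 Gw Hw; have [|i] := ns w; first by split=> //; rewrite FE mevalM Gw mul0r.
  by rewrite FE mderivM mevalD !mevalM Gw Hw mulr0 mul0r addr0 eqxx.
have GH0 : G * H != 0 by rewrite -FE.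
have [G0 H0] : G != 0 /\ H != 0 by apply/andP; rewrite -negb_or -mulf_eq0.
have GH3 : G * H \is 3.-homog by rewrite -FE.
have [i [j [ij hG hH]]] := dhomog_factor GH0 GH3.
rewrite (dhomog_msizeE G0 hG) (dhomog_msizeE H0 hH).
have [i0|i_gt0] := posnP i; first by left; rewrite i0.
have [j0|j_gt0] := posnP j; first by right; rewrite j0.
have [i1|i2] : i = 1%N \/ j = 1%N by lia.
  rewrite i1 in hG; have [w [w0 Gw Hw]] := line_meets_curve j_gt0 hG hH.
  by case: (common w).
rewrite i2 in hH; have [w [w0 Hw Gw]] := line_meets_curve i_gt0 hH hG.
by case: (common w).
Qed.

Section HilbertFunction.
Variable k : nat.

(** The image of this map is the part of degree 3 + k of the ideal generated by [F]. *)
Definition mul_cubic (x : dhomog 3 algC k) : dhomog 3 algC (3 + k) :=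
  DHomog (dhomogM F3 (dhomog_is_dhomog x)).

Fact mul_cubic_linear : linear mul_cubic.
Proof.
by move=> a x y; apply/val_inj; rewrite /= mulrDr -scalerAr.
Qed.

HB.instance Definition _ := GRing.isLinear.Build algC (dhomog 3 algC k)
  (dhomog 3 algC (3 + k)) *:%R mul_cubic mul_cubic_linear.

Lemma dim_dhomog d : \dim {: dhomog 3 algC d} = 'C(d + 2, d).
Proof. by rewrite dimvf. Qed.

Let W := limg (linfun mul_cubic).

(** Multiplication by [F] is injective, so the codimension of its image is C(k + 5, 2) - C(k + 2, 2)
    = 3 (k + 3). *)
Lemma dim_complement : \dim (W^C)%VS = (3 * (3 + k))%N.
Proof.
have inj : lker (linfun mul_cubic) == 0%VS.
  apply/lker0P => x y; rewrite !lfunE /= => /(congr1 val) /= /(mulfI F0).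
  exact: val_inj.
have dW : \dim W = 'C(k + 2, k) by rewrite limg_dim_eq ?dim_dhomog // (eqP inj) capv0.
rewrite dimv_compl dW dim_dhomog -(bin_sub (leq_addr 2 k)) addKn.
rewrite -(bin_sub (leq_addr 2 (3 + k))) addKn.
have e n : ('C(n + 2, 2) * 2 = (n + 2) * (n + 1))%N.
  by rewrite mulnC addn2 addn1 -(mul_bin_diag n.+2 1) bin1.
have := e k; have := e (3 + k)%N; nia.
Qed.

Lemma hilbert_cubic : hilbert_value F (3 + k) (3 * (3 + k)).
Proof.
rewrite -dim_complement; set U := (W^C)%VS.
pose b := vbasis U.
exists (fun i => val b`_i); split=> [i|p hp]; first exact: dhomog_is_dhomog.
have valsum (c : 'rV[algC]_(\dim U)) :
    \sum_i c 0 i *: val b`_i = val (\sum_i c 0 i *: b`_i).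
  by rewrite raddf_sum.
have /memv_addP[_ /memv_imgP[x _ ->] [y yU pE]] : DHomog hp \in (W + U)%VS.
  by rewrite addv_complf memvf.
exists (\row_i coord b i y); split.
  exists (val x); rewrite valsum.
  under eq_bigr do rewrite mxE.
  by rewrite -coord_vbasis // -[p]/(val (DHomog hp)) pE lfunE /= mulrC addrC.
move=> c' [q hq].
pose y' := \sum_i c' 0 i *: b`_i.
have y'U : y' \in U.
  apply: memv_suml => i _; apply/memvZ/vbasis_mem/mem_nth; by rewrite size_tuple.
have yy' : y' = y.
  have qF : (val x - q) * F = val (y' - y).
    have e : val y' + q * F = F * val x + val y.
      by have := congr1 val pE; rewrite /= hq valsum lfunE.
    rewrite raddfB mulrBl; apply/eqP; rewrite subr_eq addrAC e [F * _]mulrC.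
    by rewrite addrK.
  apply/eqP; rewrite -subr_eq0; apply/eqP.
  have [/eqP|nz] := eqVneq ((val x - q) * F) 0.
    by rewrite qF => /eqP z; apply: val_inj.
  have hom : (val x - q) * F \is (3 + k).-homog by rewrite qF; apply: dhomog_is_dhomog.
  (* The cofactor [q] is an arbitrary polynomial; homogeneity of the product forces [val x - q] to
     be homogeneous of degree k. *)
  have [i [j [ij hqi hFj]]] := dhomog_factor nz hom.
  have ik : i = k by move: ij; rewrite -(dhomog_uniq F0 F3 hFj) addnC => /addnI.
  rewrite {i}ik in hqi ij.
  have : y' - y \in (W :&: U)%VS.
    rewrite memv_cap; apply/andP; split; last exact: memvB.
    apply/memv_imgP; exists (DHomog hqi); first exact: memvf.
    by rewrite lfunE; apply/val_inj; rewrite -qF /= mulrC.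
  by rewrite capv_compl memv0 => /eqP.
apply/rowP => i; rewrite mxE -yy' /y'.
by rewrite (coord_sum_free _ _ (basis_free (vbasisP U))).
Qed.

End HilbertFunction.

(** The Hilbert polynomial is 3 d = 3 d + 1 - 1. *)
Lemma cubic_genus_one : has_genus F 1.
Proof.
exists 3, 3 => d d3; exists (3 * d)%N => //.
by rewrite -(subnKC d3); apply: hilbert_cubic.
Qed.

End CubicCurve.

(** * Singular fibres *)

Section Degeneracy.
Variable R : comNzRingType.

Definition quadratic_resultant (a b c a' b' c' : R) :=
  (a * c' - a' * c) ^+ 2 - (a * b' - a' * b) * (b * c' - b' * c).

(** The resultant lies in the ideal generated by the two quadratics, by the combination displayed in
    the proof. *)
Lemma quadratic_resultant_eq0 a b c a' b' c' s :
  a * s ^+ 2 + b * s + c = 0 -> a' * s ^+ 2 + b' * s + c' = 0 ->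
  quadratic_resultant a b c a' b' c' = 0.
Proof.
set P := (X in X = 0 -> _); set Q := (X in _ -> X = 0 -> _) => P0 Q0.
pose M := a * c' - a' * c; pose N := a * b' - a' * b.
transitivity (M * (a * Q - a' * P) - N * (s * (a * Q - a' * P) - (b' * P - b * Q))).
  by rewrite /quadratic_resultant /M /N /P /Q; ring.
by rewrite P0 Q0 !mulr0 !subr0 !mulr0 subr0.
Qed.

(* In S = X + Y and p = X Y the affine cubic is
   p (c S - b - c^2) + b S^2 - b c S + e = 0, and its points on X = Y are given by
   c S^3 + (3 b - c^2) S^2 - 4 b c S + 4 e = 0. *)
Definition off_diagonal (u v : R) :=
  coef_b u v ^+ 2 * (coef_c u v ^+ 2 + coef_b u v) + coef_c u v ^+ 2 * coef_e u v.

(** For the cubic P(S) on X = Y this is the resultant of P' and 3 P - S P', both of degree at most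
    2; it vanishes when P has a double root. *)
Definition on_diagonal (u v : R) :=
  let c := coef_c u v in let b := coef_b u v in
  let c2 := 3%:R * b - c ^+ 2 in let c1 := - 4%:R * b * c in let c0 := 4%:R * coef_e u v in
  quadratic_resultant (3%:R * c) (2%:R * c2) c1 c2 (2%:R * c1) (3%:R * c0).

(** The factors exclude singular points at infinity, off the diagonal X = Y, and on it. *)
Definition degeneracy (u v : R) := coef_c u v * off_diagonal u v * on_diagonal u v.

End Degeneracy.

Lemma rmorph_degeneracy (R S : comNzRingType) (f : {rmorphism R -> S}) u v :
  f (degeneracy u v) = degeneracy (f u) (f v).
Proof.
have fb : f (coef_b u v) = coef_b (f u) (f v).
  by rewrite /coef_b !(rmorphD, rmorphN, rmorphM).
have fc : f (coef_c u v) = coef_c (f u) (f v).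
  by rewrite /coef_c !(rmorphD, rmorphN, rmorph1).
have fe : f (coef_e u v) = coef_e (f u) (f v).
  by rewrite /coef_e !(rmorphD, rmorphN, rmorphM).
rewrite /degeneracy /off_diagonal /on_diagonal /quadratic_resultant -fb -fc -fe.
move: (coef_b _ _) (coef_c _ _) (coef_e _ _) => b c e.
by rewrite !(rmorph_nat, rmorphD, rmorphN, rmorphM, rmorph1).
Qed.

Section NonsingularCubic.
Variables u v : algC.
Hypothesis deg0 : degeneracy u v != 0.

Let c := coef_c u v.
Let b := coef_b u v.
Let e := coef_e u v.

Lemma degeneracy_factors :
  [/\ c != 0, off_diagonal u v != 0 & on_diagonal u v != 0].
Proof. by move: deg0; rewrite /degeneracy !mulf_eq0 !negb_or -andbA => /and3P. Qed.

(** The derivatives differ by (Y - X) (c S - b - c^2). Off the diagonal this gives c S = b + c^2,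
    and eliminating S from the cubic gives [off_diagonal] = 0. On the diagonal S is a double root of
    the restricted cubic. *)
Lemma affine_nonsingular X Y : cubic_form u v X Y 1 = 0 ->
  cubic_dX u v X Y 1 = 0 -> cubic_dX u v Y X 1 = 0 -> False.
Proof.
have [c0 k0 r0] := degeneracy_factors; have [rd rf] := coef_relations u v.
move/eqP: rd; rewrite subr_eq => /eqP rd.
rewrite (cubic_formE idfun) /cubic_dX /= rd rf -/b -/c -/e => F0 dX dY.
pose S := X + Y; pose p := X * Y.
have F0' : p * (c * S - b - c ^+ 2) + b * S ^+ 2 - b * c * S + e = 0.
  by rewrite -F0 /p /S; ring.
have [XY|XY] := eqVneq X Y.
  case/eqP: r0; rewrite /on_diagonal /= -/c -/b -/e.
  apply: (@quadratic_resultant_eq0 _ _ _ _ _ _ _ S).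
    transitivity (4%:R * (c * (2%:R * X * Y + Y ^+ 2) + b * (2%:R * X * 1)
      + (- c ^+ 2 + b) * (Y * 1) + - c * b * 1 ^+ 2)); last by rewrite dX mulr0.
    by rewrite /S XY; ring.
  transitivity (3%:R * 4%:R * (p * (c * S - b - c ^+ 2) + b * S ^+ 2 - b * c * S + e)
    - S * (4%:R * (c * (2%:R * X * Y + Y ^+ 2) + b * (2%:R * X * 1)
      + (- c ^+ 2 + b) * (Y * 1) + - c * b * 1 ^+ 2))); last first.
    by rewrite dX F0' !mulr0 subr0.
  by rewrite /S /p XY; ring.
case/eqP: k0; rewrite /off_diagonal.
have l0 : c * S - b - c ^+ 2 = 0.
  have : (Y - X) * (c * S - b - c ^+ 2) = 0.
    apply: etrans (etrans (congr2 (fun s t => s - t) dX dY) (subrr 0)).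
    by rewrite /S; ring.
  by move/eqP; rewrite mulf_eq0 subr_eq0 eq_sym (negPf XY) => /eqP.
rewrite l0 mulr0 add0r in F0'.
rewrite -/c -/b -/e.
have bE : b = c * S - c ^+ 2 by apply/eqP; rewrite -subr_eq0 -oppr_eq0 -l0; apply/eqP; ring.
have eE : e = b * c * S - b * S ^+ 2.
  by apply/eqP; rewrite -subr_eq0 -F0'; apply/eqP; ring.
by rewrite eE bE; ring.
Qed.

(** At Z = 0 the derivatives in X and Y are c Y (2 X + Y) and c X (2 Y + X), with no common zero but
    the origin. Other points are reduced to Z = 1. *)
Lemma curveC_nonsingular : nonsingular_curve (curveC u v).
Proof.
have [c0 _ _] := degeneracy_factors.
move=> P [P0 FP]; have [d0 d1 d2] := mderiv_curveC u v (P 0).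
suff : ~~ [&& (curveC u v)^`M(inord 0).@[P 0] == 0,
            (curveC u v)^`M(inord 1).@[P 0] == 0
          & (curveC u v)^`M(inord 2).@[P 0] == 0].
  by rewrite !negb_and => /or3P[] h; [exists (inord 0) | exists (inord 1) | exists (inord 2)].
rewrite d0 d1 d2; apply: contraNN P0 => /and3P[/eqP dX /eqP dY _].
rewrite [P]vec3P vec3_eq0; move: FP dX dY; rewrite meval_curveC.
move: (P 0 _) (P 0 _) (P 0 _) => Z Y X FP dX dY.
have [Z0|Z0] := eqVneq Z 0.
  rewrite {}Z0 in FP dX dY *.
  have eX : Y * (2%:R * X + Y) = 0.
    by apply: (mulfI c0); rewrite mulr0 -dX /cubic_dX -/c; ring.
  have eY : X * (2%:R * Y + X) = 0.
    by apply: (mulfI c0); rewrite mulr0 -dY /cubic_dX -/c; ring.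
  have [X0|X0] := eqVneq X 0.
    by move/eqP: eX; rewrite X0 mulr0 add0r mulf_eq0 orbb => ->.
  move/eqP: eY; rewrite mulf_eq0 (negPf X0) /= addrC addr_eq0 => /eqP XE.
  move/eqP: eX; rewrite XE mulf_eq0.
  have -> : 2%:R * - (2%:R * Y) + Y = - 3%:R * Y by ring.
  rewrite mulf_eq0 oppr_eq0 pnatr_eq0 orbb => /eqP Y0.
  by case/eqP: X0; rewrite XE Y0 mulr0 oppr0.
case: (@affine_nonsingular (X / Z) (Y / Z)).
- apply: (mulfI (expf_neq0 3 Z0)); rewrite mulr0 -FP /cubic_form.
  by field.
- apply: (mulfI (expf_neq0 2 Z0)); rewrite mulr0 -dX /cubic_dX.
  by field.
- apply: (mulfI (expf_neq0 2 Z0)); rewrite mulr0 -dY /cubic_dX.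
  by field.
Qed.

Lemma curveC_homog : curveC u v \is 3.-homog.
Proof.
have X1 i : ('X_i : {mpoly algC[3]}) \is 1.-homog by rewrite dhomogX /= mdeg1.
have X2 i : ('X_i : {mpoly algC[3]}) ^+ 2 \is 2.-homog by apply: (dhomogMn 2 (X1 i)).
rewrite /curveC (cubic_formE (@mpolyC 3 algC)) !mul_mpolyC !rpredD ?rpredZ //.
- exact: (dhomogM (dhomogM (X1 _) (X1 _)) (rpredD (X1 _) (X1 _))).
- exact: (dhomogM (rpredD (X2 _) (X2 _)) (X1 _)).
- exact: (dhomogM (dhomogM (X1 _) (X1 _)) (X1 _)).
- exact: (dhomogMn 3 (X1 _)).
- exact: (dhomogM (rpredD (X1 _) (X1 _)) (X2 _)).
Qed.

Lemma curveC_genus_one : genus_one_curve (curveC u v).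
Proof.
have F0 : curveC u v != 0.
  have [c0 _ _] := degeneracy_factors.
  have [_ d1 _] := mderiv_curveC u v (vec3 1 0 0 0).
  have [e0 e1 e2] := vec3E 1 0 0; rewrite e0 e1 e2 in d1.
  apply: contraNneq c0 => F0; move: d1; rewrite F0 mderiv0 meval0 => h.
  by apply/eqP; rewrite [RHS]h /cubic_dX -/c; ring.
have ns := curveC_nonsingular.
split=> //; first by exists 3; apply: curveC_homog.
  exact: (nonsingular_irreducible F0 curveC_homog).
exact: (cubic_genus_one F0 curveC_homog).
Qed.

End NonsingularCubic.

Lemma generic_genus_one : exists2 delta : {mpoly rat[2]}, delta != 0 &
  forall u v : algC, (map_mpoly ratr delta).@[fun i : 'I_2 => [:: u; v]`_i] != 0 ->
    genus_one_curve (curveC u v).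
Proof.
exists (degeneracy 'X_(inord 0) 'X_(inord 1)); last first.
  move=> u v; rewrite !rmorph_degeneracy /= !map_mpolyX !mevalXU !inordK //=.
  exact: curveC_genus_one.
have dE (w : 'I_2 -> rat) : (degeneracy 'X_(inord 0) 'X_(inord 1)).@[w]
    = degeneracy (w (inord 0)) (w (inord 1)).
  by rewrite rmorph_degeneracy /= !mevalXU.
(* The polynomial is nonzero because its value at (2, 1) is. *)
pose w (i : 'I_2) : rat := [:: 2; 1]`_i.
have [w0 w1] : w (inord 0) = 2 /\ w (inord 1) = 1 by rewrite /w !inordK.
have d21 : degeneracy 2 1 = 2 ^+ 8 * 3 ^+ 3 * 7 ^+ 3 :> rat.
  rewrite /degeneracy /off_diagonal /on_diagonal /quadratic_resultant.
  by rewrite /coef_b /coef_c /coef_e; ring.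
have nz : degeneracy 2 1 != 0 :> rat by rewrite d21 !mulf_neq0 ?expf_neq0.
by apply: contraNneq nz => d0; rewrite -w0 -w1 -dE d0 meval0.
Qed.

Theorem proposition1p4 :
  [/\ birational_map elliptic_threefold Bprime phi,
      exists2 delta : {mpoly rat[2]}, delta != 0 &
        forall u v : algC,
          (map_mpoly ratr delta).@[fun i : 'I_2 => [:: u; v]`_i] != 0 ->
          genus_one_curve (curveC u v),
      forall u v : algC, u + v != 1 ->
        [/\ flex_point (curveC u v) (vec3 1 0 0),
            flex_point (curveC u v) (vec3 0 1 0)
          & flex_point (curveC u v) (vec3 1 (-1) 0)]
    & zariski_dense (rational_points Bprime) Bprime].
Proof.
split; [exact: phi_birational | exact: generic_genus_one | | exact: Bprime_rational_dense].
by move=> u v uv; split; [apply: flex100 | apply: flex010 | apply: flex1N10].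
Qed.
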